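(* Let $\lambda$ be an arbitrary positive odd integer. (i) Any integer $n\ge \lambda^2/8$ can be written as $n=x^2+y^2+z^2+2w^2$ with $x,y,z,w\in\mathbb{Z}$ and $x+y+2z+2w=\lambda$. (ii) Each integer $n\ge \lambda^2/16$ can be written as $n=x^2+y^2+z^2+2w^2$ with $x,y,z,w\in\mathbb{Z}$ and $x+2y+3z+2w=\lambda$. (iii) If $7\nmid \lambda$, then for each odd integer $n\ge\lambda/\sqrt{14}$, there exist $x,y,z,w\in\mathbb{Z}$ such that $n^2=x^2+y^2+z^2+w^2$ and $x+2y+3z=\lambda$. *)

(* Defs.v *)
From Stdlib Require Export ZArith Reals.

(* Main.v *)
Require Import Defs.
From Stdlib Require Import ZArith Reals.
From Stdlib Require Import Lia Lra List Bool.
Import ListNotations.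

(** Each part reduces to writing a number [N = 1 mod 4] or [N = 6 mod 8] as a sum of three squares:
    [2 (8 n - lambda^2)] for (i), [2 (16 n - lambda^2)] for (ii) and [14 n^2 - lambda^2] for (iii),
    where the congruences and signs needed to return to [x, y, z, w] can always be arranged.
    The three-square theorem for such [N] (squarefree, without loss of generality) follows from
    an integer [a > 0] such that [-N] is a square mod [a] and [-a] is a square mod [N]: these give
    a positive ternary form of determinant one, hence three integral vectors [u, v, w] with [N = |u x v|^2].
    Dirichlet's theorem on primes is not needed to find [a].  With [chi(l) = (-N/l)] and
    [r(n) = sum_(d | n) chi(d) >= 0], one sums [r(n) / sqrt n] over the [n] satisfying [(n/p) = (-1/p)]
    for all odd primes [p | N], by expanding these conditions into characters.  Every nontrivial
    character contributes [O(1)] by Dirichlet's hyperbola method, while the trivial one diverges,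
    since [r(m^2) >= 1].  So such an [n] exists with [r(n) > 0], and [a] is its squarefree part. *)

Open Scope Z_scope.

(** * Ternary forms of determinant one *)

Lemma round_div (b a : Z) : 0 < a -> exists k, -a <= 2 * (b - k * a) <= a.
Proof.
  intros Ha; exists ((2 * b + a) / (2 * a)).
  pose proof (Z.div_mod (2 * b + a) (2 * a) ltac:(lia)).
  pose proof (Z.mod_pos_bound (2 * b + a) (2 * a) ltac:(lia)).
  nia.
Qed.

(** Gauss reduction of the binary form with coefficients [A], [2 B], [C]: shear until [2 |B| <= A],
    then exchange the outer coefficients if [C < A], which lowers [A]. Once [A <= C], the bound
    follows from [A^2 <= A C = D + B^2 <= D + A^2 / 4]. *)
Lemma binary_reduction (D : Z) : forall A B C, 0 < A -> A * C - B * B = D -> 0 < D ->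
  exists p q r s, p * s - q * r = 1 /\
    3 * (A * p * p + 2 * B * p * r + C * r * r) ^ 2 <= 4 * D /\
    0 < A * p * p + 2 * B * p * r + C * r * r.
Proof.
  intros A; induction A as [A IH] using (well_founded_induction (Z.lt_wf 0)).
  intros B C HA HD HD0.
  destruct (round_div B A HA) as [k Hk].
  set (B' := B - k * A) in *.
  set (C' := C - 2 * k * B + k * k * A).
  assert (HD' : A * C' - B' * B' = D) by (subst B' C'; lia).
  assert (HC' : 0 < C') by nia.
  destruct (Z_lt_le_dec C' A) as [Hlt | Hle].
  (* The exchange is a rotation of the two variables, of determinant 1, which turns [B'] into
     [- B']. *)
  - destruct (IH C' ltac:(lia) (- B') A ltac:(lia) ltac:(lia) HD0) as (p & q & r & s & H1 & H2 & H3).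
    replace (C' * p * p + 2 * - B' * p * r + A * r * r)
      with (A * (- r - k * p) * (- r - k * p) + 2 * B * (- r - k * p) * p + C * p * p)
      in * by (subst B' C'; ring).
    exists (- r - k * p), (- s - k * q), p, q.
    repeat split; auto. lia.
  - exists 1, 0, 0, 1. split; [ring|].
    replace (A * 1 * 1 + 2 * B * 1 * 0 + C * 0 * 0) with A by ring.
    split; nia.
Qed.

(* Gram matrix of [u, v, w]: [a, b, c] are the squared norms, [d, e, f] the products [u.v, u.w, v.w]. *)
Definition gram (a b c d e f : Z) :=
  exists u1 u2 u3 v1 v2 v3 w1 w2 w3,
    a = u1 * u1 + u2 * u2 + u3 * u3 /\ b = v1 * v1 + v2 * v2 + v3 * v3 /\
    c = w1 * w1 + w2 * w2 + w3 * w3 /\ d = u1 * v1 + u2 * v2 + u3 * v3 /\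
    e = u1 * w1 + u2 * w2 + u3 * w3 /\ f = v1 * w1 + v2 * w2 + v3 * w3.

(** Determinant of the symmetric matrix with rows [a d e], [d b f], [e f c]. *)
Definition det3 (a b c d e f : Z) := a * b * c + 2 * d * e * f - a * f * f - b * e * e - c * d * d.

(** This and the next three lemmas allow an integral change of basis before the vectors are sought;
    its inverse is applied to the vectors found. *)
Lemma gram_swap a b c d e f : gram b a c d f e -> gram a b c d e f.
Proof.
  intros (u1 & u2 & u3 & v1 & v2 & v3 & w1 & w2 & w3 & H).
  exists v1, v2, v3, u1, u2, u3, w1, w2, w3; intuition (subst; ring).
Qed.

Lemma gram_shear_v k a b c d e f :
  gram a (b - 2 * k * d + k * k * a) c (d - k * a) e (f - k * e) -> gram a b c d e f.
Proof.
  intros (u1 & u2 & u3 & v1 & v2 & v3 & w1 & w2 & w3 & H1 & H2 & H3 & H4 & H5 & H6).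
  exists u1, u2, u3, (v1 + k * u1), (v2 + k * u2), (v3 + k * u3), w1, w2, w3.
  repeat split; auto; nia.
Qed.

Lemma gram_shear_w k a b c d e f :
  gram a b (c - 2 * k * e + k * k * a) d (e - k * a) (f - k * d) -> gram a b c d e f.
Proof.
  intros (u1 & u2 & u3 & v1 & v2 & v3 & w1 & w2 & w3 & H1 & H2 & H3 & H4 & H5 & H6).
  exists u1, u2, u3, v1, v2, v3, (w1 + k * u1), (w2 + k * u2), (w3 + k * u3).
  repeat split; auto; nia.
Qed.

Lemma gram_SL2 p q r s a b c d e f : p * s - q * r = 1 ->
  gram a (p * p * b + 2 * p * r * f + r * r * c) (q * q * b + 2 * q * s * f + s * s * c)
    (p * d + r * e) (q * d + s * e) (p * q * b + (p * s + q * r) * f + r * s * c) ->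
  gram a b c d e f.
Proof.
  intros Hdet (u1 & u2 & u3 & v1 & v2 & v3 & w1 & w2 & w3 & H1 & H2 & H3 & H4 & H5 & H6).
  exists u1, u2, u3, (s * v1 - r * w1), (s * v2 - r * w2), (s * v3 - r * w3),
    (p * w1 - q * v1), (p * w2 - q * v2), (p * w3 - q * v3).
  (* Each entry is multiplied by a power of [m = 1], which leaves polynomial identities valid for
     all [p, q, r, s]. *)
  set (m := p * s - q * r) in *.
  split; [exact H1|]. repeat split.
  - transitivity (m ^ 2 * b); [rewrite Hdet; ring|].
    transitivity (s * s * (p * p * b + 2 * p * r * f + r * r * c) - 2 * s * r * (p * q * b + (p * s + q * r) * f + r * s * c) + r * r * (q * q * b + 2 * q * s * f + s * s * c)); [subst m; ring | rewrite H2, H3, H6; ring].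
  - transitivity (m ^ 2 * c); [rewrite Hdet; ring|].
    transitivity (q * q * (p * p * b + 2 * p * r * f + r * r * c) - 2 * q * p * (p * q * b + (p * s + q * r) * f + r * s * c) + p * p * (q * q * b + 2 * q * s * f + s * s * c)); [subst m; ring | rewrite H2, H3, H6; ring].
  - transitivity (m ^ 1 * d); [rewrite Hdet; ring|].
    transitivity (s * (p * d + r * e) - r * (q * d + s * e)); [subst m; ring | rewrite H4, H5; ring].
  - transitivity (m ^ 1 * e); [rewrite Hdet; ring|].
    transitivity (p * (q * d + s * e) - q * (p * d + r * e)); [subst m; ring | rewrite H4, H5; ring].
  - transitivity (m ^ 2 * f); [rewrite Hdet; ring|].
    transitivity ((p * s + q * r) * (p * q * b + (p * s + q * r) * f + r * s * c) - s * q * (p * p * b + 2 * p * r * f + r * r * c) - r * p * (q * q * b + 2 * q * s * f + s * s * c)); [subst m; ring | rewrite H2, H3, H6; ring].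
Qed.

(** Shearing by the vector of norm 1 clears [d] and [e] and splits off a binary form of determinant
    1. Its reduction has leading coefficient 1, and is realised by [(0, 1, 0)] and [(0, F', 1)]. *)
Lemma gram_unit_corner b c d e f : 0 < b - d * d -> det3 1 b c d e f = 1 -> gram 1 b c d e f.
Proof.
  unfold det3; intros Hpos Hdet.
  apply (gram_shear_v d), (gram_shear_w e).
  replace (d - d * 1) with 0 by ring; replace (e - e * 1) with 0 by ring.
  set (B := b - 2 * d * d + d * d * 1). set (C := c - 2 * e * e + e * e * 1).
  set (F := f - d * e - e * 0).
  assert (HBC : B * C - F * F = 1) by (subst B C F; lia).
  assert (HB : 0 < B) by (subst B; lia).
  clearbody B C F; clear - HB HBC.
  destruct (binary_reduction 1 B F C HB HBC ltac:(lia)) as (p & q & r & s & H1 & H2 & H3).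
  apply (gram_SL2 p q r s); [exact H1|].
  replace (p * 0 + r * 0) with 0 by ring; replace (q * 0 + s * 0) with 0 by ring.
  set (B' := p * p * B + 2 * p * r * F + r * r * C).
  set (C' := q * q * B + 2 * q * s * F + s * s * C).
  set (F' := p * q * B + (p * s + q * r) * F + r * s * C).
  assert (EB : B' = 1).
  { replace (B * p * p + 2 * F * p * r + C * r * r) with B' in * by (subst B'; ring). nia. }
  assert (HBC' : B' * C' - F' * F' = 1).
  { transitivity ((p * s - q * r) ^ 2 * (B * C - F * F)); [subst B' C' F'; ring | rewrite H1, HBC; ring]. }
  rewrite EB in *.
  exists 1, 0, 0, 0, 1, 0, 0, F', 1. repeat split; nia.
Qed.

(** Descent on [a]. Completing the square leaves a binary form of determinant [a] times the ternary
    one; it is reduced first, then [d] is made small by a shear. If the new [b] is below [a], the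
    first two vectors are exchanged; otherwise [a = 1]. *)
Lemma gram_of_det1 : forall a b c d e f, 0 < a -> 0 < a * b - d * d -> det3 a b c d e f = 1 ->
  gram a b c d e f.
Proof.
  intros a; induction a as [a IH] using (well_founded_induction (Z.lt_wf 0)).
  intros b c d e f Ha Hab Hdet.
  assert (HK : (a * b - d * d) * (a * c - e * e) - (a * f - d * e) * (a * f - d * e) = a).
  { transitivity (a * det3 a b c d e f); [unfold det3; ring | rewrite Hdet; ring]. }
  destruct (binary_reduction a _ _ _ Hab HK Ha) as (p & q & r & s & H1 & H2 & H3).
  apply (gram_SL2 p q r s); [exact H1|].
  set (b1 := p * p * b + 2 * p * r * f + r * r * c).
  set (c1 := q * q * b + 2 * q * s * f + s * s * c).
  set (d1 := p * d + r * e). set (e1 := q * d + s * e).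
  set (f1 := p * q * b + (p * s + q * r) * f + r * s * c).
  assert (Hdet1 : det3 a b1 c1 d1 e1 f1 = 1).
  { transitivity ((p * s - q * r) ^ 2 * det3 a b c d e f);
      [unfold det3; subst b1 c1 d1 e1 f1; ring | rewrite H1, Hdet; ring]. }
  replace ((a * b - d * d) * p * p + 2 * (a * f - d * e) * p * r + (a * c - e * e) * r * r)
    with (a * b1 - d1 * d1) in * by (subst b1 d1; ring).
  clearbody b1 c1 d1 e1 f1; clear - IH Ha H2 H3 Hdet1.
  destruct (round_div d1 a Ha) as [k Hk].
  apply (gram_shear_v k).
  set (b2 := b1 - 2 * k * d1 + k * k * a). set (d2 := d1 - k * a) in *. set (f2 := f1 - k * e1).
  assert (Hdet2 : det3 a b2 c1 d2 e1 f2 = 1).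
  { unfold det3 in *; subst b2 d2 f2; lia. }
  replace (a * b1 - d1 * d1) with (a * b2 - d2 * d2) in * by (subst b2 d2; ring).
  clearbody b2 d2 f2; clear Hdet1.
  assert (Hb2 : 0 < b2) by nia.
  destruct (Z_lt_le_dec b2 a) as [Hlt | Hle].
  - apply gram_swap, IH; [lia | lia | lia |].
    unfold det3 in *; lia.
  (* Now [3 a^2 / 4] is at most the leading coefficient [a b2 - d2^2] of the reduced binary form,
     whence [27 a^4 <= 64 a]. *)
  - assert (Ea : a = 1).
    { assert (4 * (d2 * d2) <= a * a) by nia.
      assert (3 * (a * a) <= 4 * (a * b2 - d2 * d2)) by nia.
      assert (0 < a * a) by nia.
      assert (3 * (3 * (a * a)) ^ 2 <= 64 * a) by nia.
      nia. }
    subst a. apply gram_unit_corner; [lia | exact Hdet2].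
Qed.

Definition sum3sq (N : Z) := exists x y z, N = x * x + y * y + z * z.

(* The matrix [a b 0; b c s; 0 s t], with [a c - b^2 = N] and [N t - a s^2 = 1], has determinant 1;
   if it is the Gram matrix of [u, v, w], then [N = |u|^2 |v|^2 - (u.v)^2 = |u x v|^2]. *)
Lemma sum3sq_of_residues (N a b s : Z) : 0 < N -> 0 < a ->
  (a | b * b + N) -> (N | a * (s * s) + 1) -> sum3sq N.
Proof.
  intros HN Ha [c Hc] [t Ht].
  destruct (gram_of_det1 a c t b 0 s Ha ltac:(nia)) as
    (u1 & u2 & u3 & v1 & v2 & v3 & w1 & w2 & w3 & H1 & H2 & H3 & H4 & H5 & H6).
  { unfold det3. nia. }
  exists (u2 * v3 - u3 * v2), (u3 * v1 - u1 * v3), (u1 * v2 - u2 * v1).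
  transitivity (a * c - b * b); [lia|]. rewrite H1, H2, H4; ring.
Qed.

(** * Reduction to sums of three squares *)

Lemma square_mod8 x : exists k,
  (x = 2 * k) \/ (Z.Odd x /\ x * x = 8 * k + 1).
Proof.
  destruct (Z.Even_or_Odd x) as [[k ->] | Hx]; [exists k; auto|].
  pose proof Hx as [k ->].
  destruct (Z.Even_or_Odd k) as [[j ->] | [j ->]];
    [exists (2 * j * j + j) | exists (2 * j * j + 3 * j + 1)]; right; split; auto; lia.
Qed.

Lemma odd_square x : Z.Odd x -> exists k, x * x = 8 * k + 1.
Proof.
  intros Hx; destruct (square_mod8 x) as [k [-> | [_ H]]]; [destruct Hx; lia | eauto].
Qed.

(** Squares are 0, 1 or 4 modulo 8, and 6 = 4 + 1 + 1 is the only decomposition. *)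
Lemma sum3sq_6mod8 N : sum3sq N -> N mod 8 = 6 -> exists e f g,
  N = (2 * e) ^ 2 + f ^ 2 + g ^ 2 /\ Z.Odd e /\ Z.Odd f /\ Z.Odd g.
Proof.
  intros (x & y & z & HN) H6.
  pose proof (Z.div_mod N 8 ltac:(lia)) as HM; rewrite H6 in HM; set (M := N / 8) in HM; clearbody M; clear H6.
  assert (key : forall e f g, N = (2 * e) ^ 2 + f ^ 2 + g ^ 2 -> Z.Odd f -> Z.Odd g -> exists e f g,
    N = (2 * e) ^ 2 + f ^ 2 + g ^ 2 /\ Z.Odd e /\ Z.Odd f /\ Z.Odd g).
  { intros e f g H Hf Hg; exists e, f, g; repeat split; auto.
    destruct (odd_square f Hf) as [i Hi], (odd_square g Hg) as [j Hj].
    destruct (Z.Even_or_Odd e) as [[k ->] | He]; [exfalso; lia | exact He]. }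
  destruct (square_mod8 x) as [i [-> | [Ox Hx]]], (square_mod8 y) as [j [-> | [Oy Hy]]],
    (square_mod8 z) as [k [-> | [Oz Hz]]]; try (exfalso; lia).
  - apply (key i y z); auto; lia.
  - apply (key j x z); auto; lia.
  - apply (key k x y); auto; lia.
Qed.

(** [l + x] and [l - x] are even and differ by [2 x], which is 2 modulo 4. *)
Lemma odd_sign_mod4 l x : Z.Odd l -> Z.Odd x -> exists k x', (x' = x \/ x' = - x) /\ x' + l = 4 * k.
Proof.
  intros [a ->] [b ->].
  destruct (Z.Even_or_Odd (a + b)) as [[k H] | [k H]].
  - exists (a - k), (- (2 * b + 1)); split; [auto | lia].
  - exists (k + 1), (2 * b + 1); split; [auto | lia].
Qed.

(* In [2 (16 n - lambda ^ 2) = 4 e ^ 2 + f ^ 2 + g ^ 2] one has [lambda = e - 4 c], [f = 2 h - e]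
   and [g = 2 h + e + 8 k]. *)
Lemma sum_with_form_1232_core n e c h k : Z.Odd e ->
  32 * n = 4 * e ^ 2 + (2 * h - e) ^ 2 + (2 * h + e + 8 * k) ^ 2 + 2 * (e - 4 * c) ^ 2 ->
  exists x y z w, n = x ^ 2 + y ^ 2 + z ^ 2 + 2 * w ^ 2 /\ x + 2 * y + 3 * z + 2 * w = e - 4 * c.
Proof.
  intros He H.
  (* This is the hypothesis divided by 8. Modulo 2 it makes [h] odd, then modulo 4 it makes [k - c]
     odd. *)
  assert (H4 : 4 * n = e * e + h * h + 2 * (e * (k - c)) + 8 * (k * k) + 4 * (h * k) + 4 * (c * c)) by lia.
  destruct (odd_square e He) as [i Hi].
  assert (Hh : Z.Odd h).
  { destruct (Z.Even_or_Odd h) as [[j ->] | Hh]; [exfalso; lia | exact Hh]. }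
  destruct (odd_square h Hh) as [j Hj].
  assert (Hkc : Z.Odd (k - c)).
  { destruct (Z.Even_or_Odd (k - c)) as [[d Hd] | Hkc]; [exfalso; rewrite Hd in H4; lia | exact Hkc]. }
  destruct He as [e' ->], Hkc as [d Hd].
  assert (core : forall h m, h = k + c - 4 * m ->
    4 * n = (2 * e' + 1) * (2 * e' + 1) + h * h + 2 * ((2 * e' + 1) * (k - c)) + 8 * (k * k)
            + 4 * (h * k) + 4 * (c * c) ->
    exists x y z w, n = x ^ 2 + y ^ 2 + z ^ 2 + 2 * w ^ 2 /\ x + 2 * y + 3 * z + 2 * w = 2 * e' + 1 - 4 * c).
  { intros h' m -> E.
    exists (- m), (e' + d + 1), (m - k - c), (k - m).
    assert (Ek : k = c + 2 * d + 1) by (clear - Hd; lia). subst k.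
    split; [|ring]. apply (Z.mul_reg_l _ _ 4); [discriminate|]. rewrite E; ring. }
  assert (Odd_kc : Z.Odd (- (k + c))) by (exists (- d - 1 - c); lia).
  destruct (odd_sign_mod4 (- (k + c)) h Odd_kc Hh) as (m & h' & [-> | ->] & Hm).
  - apply (core h (- m)); [lia | exact H4].
  (* Replacing [h] by [- h - 4 k] exchanges [f] and [g] up to sign, so the sum of squares is
     unchanged. *)
  - apply (core (- h - 4 * k) (k - m)); [lia | lia].
Qed.

(** * Signs and order of the squares modulo 7 *)

Definition residues7 : list Z := [0; 1; 2; 3; 4; 5; 6].

Lemma in_residues7 x : In (x mod 7) residues7.
Proof. pose proof (Z.mod_pos_bound x 7 ltac:(lia)); cbn; lia. Qed.

(* Says that 7 divides the quaternion [(l + a i + b j + c k) (1 + 3 i + 2 j)].  Modulo 7 there are eight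
   left ideals of quaternions of norm 0; sign changes and the swap of [b] and [c] permute them transitively. *)
Definition right_divisible7 (l a b c : Z) : bool :=
  ((l - 3 * a - 2 * b) mod 7 =? 0) && ((3 * l + a - 2 * c) mod 7 =? 0) &&
  ((2 * l + b + 3 * c) mod 7 =? 0) && ((c + 2 * a - 3 * b) mod 7 =? 0).

(** A boolean implication: it is [true] by default when [l] is 0 or the norm is not divisible by 7,
    so that one computation over all quadruples of residues settles the matter. *)
Definition arrangement7 (l a b c : Z) : bool :=
  if l =? 0 then true else
  if (l * l + a * a + b * b + c * c) mod 7 =? 0 then
    existsb (fun s => existsb (fun t => existsb (fun u =>
      right_divisible7 l (s * a) (t * b) (u * c) || right_divisible7 l (s * a) (t * c) (u * b))
      [1; -1]) [1; -1]) [1; -1]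
  else true.

Lemma arrangement7_residues :
  forallb (fun l => forallb (fun a => forallb (fun b => forallb (arrangement7 l a b)
    residues7) residues7) residues7) residues7 = true.
Proof. vm_compute; reflexivity. Qed.

Lemma right_divisible7_iff l a b c : right_divisible7 l a b c = true <->
  ((7 | l - 3 * a - 2 * b) /\ (7 | 3 * l + a - 2 * c)) /\ (7 | 2 * l + b + 3 * c) /\ (7 | c + 2 * a - 3 * b).
Proof.
  unfold right_divisible7; rewrite !andb_true_iff, !Z.eqb_eq, !Z.mod_divide by lia; tauto.
Qed.

Lemma right_divisible7_congr l a b c l' a' b' c' :
  (7 | l - l') -> (7 | a - a') -> (7 | b - b') -> (7 | c - c') ->
  right_divisible7 l' a' b' c' = true -> right_divisible7 l a b c = true.
Proof.
  rewrite !right_divisible7_iff.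
  intros [i1 E1] [i2 E2] [i3 E3] [i4 E4] [[[j1 F1] [j2 F2]] [[j3 F3] [j4 F4]]].
  repeat split; [exists (j1 + i1 - 3 * i2 - 2 * i3) | exists (j2 + 3 * i1 + i2 - 2 * i4)
    | exists (j3 + 2 * i1 + i3 + 3 * i4) | exists (j4 + i4 + 2 * i2 - 3 * i3)]; lia.
Qed.

(** Everything depends only on residues modulo 7, so the finite check applies. Only [b] and [c] may
    trade places: in the application [a] is odd and the other two are even. *)
Lemma exists_arrangement7 l a b c : ~ (7 | l) -> (7 | l * l + a * a + b * b + c * c) ->
  exists a' b' c', (a' = a \/ a' = - a) /\
    ((b' = b \/ b' = - b) /\ (c' = c \/ c' = - c) \/ (b' = c \/ b' = - c) /\ (c' = b \/ c' = - b)) /\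
    right_divisible7 l a' b' c' = true.
Proof.
  intros Hl Hs. pose proof arrangement7_residues as H.
  assert (D : forall x, (7 | x - x mod 7)).
  { intro x; exists (x / 7); rewrite (Z.div_mod x 7) at 1 by lia; ring. }
  rewrite forallb_forall in H; specialize (H _ (in_residues7 l)).
  rewrite forallb_forall in H; specialize (H _ (in_residues7 a)).
  rewrite forallb_forall in H; specialize (H _ (in_residues7 b)).
  rewrite forallb_forall in H; specialize (H _ (in_residues7 c)).
  unfold arrangement7 in H.
  rewrite (proj2 (Z.eqb_neq _ _)) in H by (rewrite Z.mod_divide by lia; exact Hl).
  rewrite (proj2 (Z.eqb_eq _ _)) in H; cycle 1.
  { apply Z.mod_divide; [lia|].
    destruct (D l) as [i1 E1], (D a) as [i2 E2], (D b) as [i3 E3], (D c) as [i4 E4], Hs as [t Ht].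
    replace (l mod 7) with (l - i1 * 7) by lia; replace (a mod 7) with (a - i2 * 7) by lia.
    replace (b mod 7) with (b - i3 * 7) by lia; replace (c mod 7) with (c - i4 * 7) by lia.
    exists (t - 2 * (i1 * l + i2 * a + i3 * b + i4 * c)
      + 7 * (i1 * i1 + i2 * i2 + i3 * i3 + i4 * i4)). clear - Ht; lia. }
  apply existsb_exists in H; destruct H as (s & Hs' & H).
  apply existsb_exists in H; destruct H as (t & Ht' & H).
  apply existsb_exists in H; destruct H as (u & Hu' & H).
  assert (S : forall x y, In x [1; -1] -> x * y = y \/ x * y = - y).
  { intros x y [<- | [<- | []]]; [left | right]; ring. }
  assert (D' : forall x y, (7 | x * y - x * (y mod 7))).
  { intros x y; rewrite <- Z.mul_sub_distr_l; apply Z.divide_mul_r, D. }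
  apply orb_true_iff in H; destruct H as [H | H].
  - exists (s * a), (t * b), (u * c).
    split; [auto | split; [left; auto|]]. revert H; apply right_divisible7_congr; auto.
  - exists (s * a), (t * c), (u * b).
    split; [auto | split; [right; auto|]]. revert H; apply right_divisible7_congr; auto.
Qed.

(** * The three representations, given the three-square theorem *)

Section FromThreeSquares.
Hypothesis three_squares : forall N, 0 < N -> N mod 4 = 1 \/ N mod 8 = 6 -> sum3sq N.

(** With [lam = x + y + 2 z + 2 w], one has [8 n = lam^2 + (4 z - lam)^2 + 4 (x - y)^2 + 2 (4 w + 2
    z - lam)^2]. The three squares are brought to this shape and solved for [z], [w], [y], [x]. *)
Lemma sum_with_form_1122 lam n : Z.Odd lam -> lam ^ 2 <= 8 * n -> exists x y z w,
  n = x ^ 2 + y ^ 2 + z ^ 2 + 2 * w ^ 2 /\ x + y + 2 * z + 2 * w = lam.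
Proof.
  intros Hl Hn; destruct (odd_square lam Hl) as [L HL].
  destruct (sum3sq_6mod8 (2 * (8 * n - lam * lam))) as (e & f & g & HN & [e' He] & [f' Hf] & [g' Hg]).
  { apply three_squares; [lia|]. right; rewrite HL.
    symmetry; apply (Z.mod_unique_pos _ _ (2 * n - 2 * L - 1)); lia. }
  { rewrite HL; symmetry; apply (Z.mod_unique_pos _ _ (2 * n - 2 * L - 1)); lia. }
  (* [s] and [d] are half the sum and half the difference of [f] and [g]. As [s + d = f] is odd,
     exactly one of them is odd and serves as [A]; the other is [2 D]. *)
  set (s := f' + g' + 1). set (d := f' - g').
  assert (Hm : 8 * n - lam * lam = s * s + d * d + 2 * (e * e)) by (subst s d; lia).
  assert (key : forall A D, Z.Odd A -> 8 * n - lam * lam = A * A + (2 * D) * (2 * D) + 2 * (e * e) ->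
    exists x y z w, n = x ^ 2 + y ^ 2 + z ^ 2 + 2 * w ^ 2 /\ x + y + 2 * z + 2 * w = lam).
  { intros A D HA H.
    (* The oddness of [D] makes [lam - 2 z - 2 w - D] even, so that [y] is an integer. *)
    assert (HD : Z.Odd D).
    { destruct (odd_square A HA) as [i Hi], (odd_square e (ex_intro _ e' He)) as [j Hj].
      destruct (Z.Even_or_Odd D) as [[k ->] | HD]; [exfalso; lia | exact HD]. }
    destruct (odd_sign_mod4 lam A Hl HA) as (z & A' & HA' & Hz).
    destruct (odd_sign_mod4 (lam - 2 * z) e) as (w & B & HB & Hw).
    { destruct Hl as [l ->]; exists (l - z); lia. }
    { exists e'; exact He. }
    destruct Hl as [l Hl], HD as [D' HD].
    set (y := l - z - w - D').
    exists (y + D), y, z, w.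
    assert (A * A = A' * A') by (destruct HA' as [-> | ->]; ring).
    assert (e * e = B * B) by (destruct HB as [-> | ->]; ring).
    assert (Hy : 2 * y = lam - 2 * z - 2 * w - D) by lia.
    split; [|lia].
    assert (EA : A' = 4 * z - lam) by lia. assert (EB : B = 4 * w + 2 * z - lam) by lia.
    assert (El : lam = 2 * y + D + 2 * z + 2 * w) by lia.
    assert (E : 8 * n = 8 * ((y + D) ^ 2 + y ^ 2 + z ^ 2 + 2 * w ^ 2)); [|clear - E; lia].
    transitivity (lam * lam + A * A + 4 * (D * D) + 2 * (e * e)); [clear - H; lia|].
    rewrite H0, H1, EA, EB, El; ring. }
  destruct (Z.Even_or_Odd s) as [[k Hk] | Hs].
  - apply (key d k); [exists (k - g' - 1); lia | rewrite Hm, Hk; ring].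
  - pose proof Hs as [k Hk].
    apply (key s (k - g')); [exact Hs|].
    replace (2 * (k - g')) with d by (subst s d; clear - Hk; lia). exact Hm.
Qed.

(** In the solution, up to sign and the order of [f] and [g], [e = x + 2 y - z - 2 w],
    [f = 5 x - 2 y - z + 2 w] and [g = x - 2 y + 3 z - 6 w]; then
    [4 e^2 + f^2 + g^2 + 2 lam^2 = 32 n]. *)
Lemma sum_with_form_1232 lam n : Z.Odd lam -> lam ^ 2 <= 16 * n -> exists x y z w,
  n = x ^ 2 + y ^ 2 + z ^ 2 + 2 * w ^ 2 /\ x + 2 * y + 3 * z + 2 * w = lam.
Proof.
  intros Hl Hn; destruct (odd_square lam Hl) as [L HL].
  destruct (sum3sq_6mod8 (2 * (16 * n - lam * lam))) as (e & f & g & HN & He & Hf & Hg).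
  { apply three_squares; [lia|]. right; rewrite HL.
    symmetry; apply (Z.mod_unique_pos _ _ (4 * n - 2 * L - 1)); lia. }
  { rewrite HL; symmetry; apply (Z.mod_unique_pos _ _ (4 * n - 2 * L - 1)); lia. }
  clear L HL Hn.
  (* Signs are fixed in turn so that 4 divides [f + g'], then 8 divides [f + 2 e' - g'], then 4
     divides [e'' - lam]. *)
  destruct (odd_sign_mod4 f g Hf Hg) as (i & g' & Hg' & Hi).
  assert (Hu : Z.Odd (f - 2 * i)) by (destruct Hf as [f' ->]; exists (f' - i); lia).
  destruct (odd_sign_mod4 _ e Hu He) as (j & e' & He' & Hj).
  assert (Oe' : Z.Odd e').
  { destruct Hu as [u Hu]; exists (2 * j - u - 1); lia. }
  assert (Hl' : Z.Odd (- lam)) by (destruct Hl as [l ->]; exists (- l - 1); lia).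
  destruct (odd_sign_mod4 _ e' Hl' Oe') as (c & e'' & He'' & Hc).
  assert (HN' : 32 * n = 4 * e' ^ 2 + f ^ 2 + g' ^ 2 + 2 * lam ^ 2).
  { destruct He' as [-> | ->], Hg' as [-> | ->]; lia. }
  assert (Hfe : exists h, f = 2 * h - e').
  { destruct Hf as [f' ->], Oe' as [d ->]; exists (f' + d + 1); lia. }
  destruct Hfe as [h Hh].
  replace lam with (e'' - 4 * c) in * by (clear - Hc; lia).
  destruct He'' as [-> | ->].
  - apply (sum_with_form_1232_core n e' c h (- j)); [exact Oe'|].
    rewrite HN'. replace (2 * h + e' + 8 * - j) with g' by (clear - Hi Hj Hh; lia).
    rewrite <- Hh; ring.
  (* If the last sign is negative, [f] and [g'] are negated along with [e'], which preserves the
     earlier divisibilities. *)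
  - apply (sum_with_form_1232_core n (- e') c (- h) j); [destruct Oe' as [d ->]; exists (- d - 1); lia|].
    rewrite HN'. replace (2 * - h + - e' + 8 * j) with (- g') by (clear - Hi Hj Hh; lia).
    replace (2 * - h - - e') with (- f) by (clear - Hh; lia). ring.
Qed.

(** The quaternion [lam + a i + b j + c k] has norm [14 n^2]. Its product with [1 + 3 i + 2 j], of
    norm 14, is made divisible by 14; the quotient [x + z i + y j + w k] has norm [n^2], and
    [x + 2 y + 3 z = lam] because the terms in [a], [b], [c] cancel. *)
Lemma square_with_form_1230 lam n : Z.Odd lam -> ~ (7 | lam) -> Z.Odd n -> lam ^ 2 <= 14 * n ^ 2 ->
  exists x y z w, n ^ 2 = x ^ 2 + y ^ 2 + z ^ 2 + w ^ 2 /\ x + 2 * y + 3 * z = lam.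
Proof.
  intros Hl H7 Hn Hle. destruct (odd_square lam Hl) as [L HL], (odd_square n Hn) as [M HM].
  destruct (three_squares (14 * (n * n) - lam * lam)) as (a & b & c & HN).
  { lia. }
  { left; symmetry; rewrite HM, HL; apply (Z.mod_unique_pos _ _ (28 * M + 3 - 2 * L)); lia. }
  assert (key : forall a b c, Z.Odd a -> 14 * (n * n) - lam * lam = a * a + (2 * b) * (2 * b) + (2 * c) * (2 * c) ->
    exists x y z w, n ^ 2 = x ^ 2 + y ^ 2 + z ^ 2 + w ^ 2 /\ x + 2 * y + 3 * z = lam).
  { clear - Hl H7. intros a b c Ha H.
    destruct (exists_arrangement7 lam a (2 * b) (2 * c) H7) as (a' & b' & c' & Ha' & Hbc & Hdiv).
    { exists (2 * (n * n)); lia. }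
    assert (Hs : 14 * (n * n) = lam * lam + a' * a' + b' * b' + c' * c').
    { clear - H Ha' Hbc; destruct Ha' as [-> | ->], Hbc as [[[-> | ->] [-> | ->]] | [[-> | ->] [-> | ->]]]; lia. }
    assert (Hb : exists d, b' = 2 * d).
    { clear - Hbc; destruct Hbc as [[[-> | ->] _] | [[-> | ->] _]];
        [exists b | exists (- b) | exists c | exists (- c)]; ring. }
    assert (Hc : exists d, c' = 2 * d).
    { clear - Hbc; destruct Hbc as [[_ [-> | ->]] | [_ [-> | ->]]];
        [exists c | exists (- c) | exists b | exists (- b)]; ring. }
    assert (Ha2 : Z.Odd a').
    { destruct Ha as [d ->], Ha' as [-> | ->]; [exists d | exists (- d - 1)]; ring. }
    clear a b c Ha H Ha' Hbc.
    destruct Hb as [b ->], Hc as [c ->], Ha2 as [a ->], Hl as [l ->].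
    apply right_divisible7_iff in Hdiv; destruct Hdiv as [[[x Hx] [z Hz]] [[y Hy] [w Hw]]].
    (* Divisibility by 2 comes from parity: [lam] and [a] are odd, the other two coordinates
       even. *)
    assert (Ex : exists x', x = 2 * x') by (exists (l - 3 * a - 1 - 2 * b - 3 * x); lia).
    assert (Ez : exists z', z = 2 * z') by (exists (3 * l + a + 2 - 2 * c - 3 * z); lia).
    assert (Ey : exists y', y = 2 * y') by (exists (2 * l + 1 + b + 3 * c - 3 * y); lia).
    assert (Ew : exists w', w = 2 * w') by (exists (c + 2 * a + 1 - 3 * b - 3 * w); lia).
    destruct Ex as [x' ->], Ey as [y' ->], Ez as [z' ->], Ew as [w' ->].
    exists x', y', z', w'; split; [|lia].
    apply (Z.mul_reg_l _ _ (14 * 14)); [discriminate|].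
    transitivity ((14 * x') ^ 2 + (14 * y') ^ 2 + (14 * z') ^ 2 + (14 * w') ^ 2); [|ring].
    replace (14 * x') with (2 * l + 1 - 3 * (2 * a + 1) - 2 * (2 * b)) by lia.
    replace (14 * y') with (2 * (2 * l + 1) + 2 * b + 3 * (2 * c)) by lia.
    replace (14 * z') with (3 * (2 * l + 1) + (2 * a + 1) - 2 * (2 * c)) by lia.
    replace (14 * w') with (2 * c + 2 * (2 * a + 1) - 3 * (2 * b)) by lia.
    transitivity (14 * (14 * (n * n))); [ring|]. rewrite Hs; ring. }
  destruct (square_mod8 a) as [i [-> | [Oa Ea]]], (square_mod8 b) as [j [-> | [Ob Eb]]],
    (square_mod8 c) as [k [-> | [Oc Ec]]]; try (exfalso; lia).
  - apply (key c i j); auto; lia.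
  - apply (key b i k); auto; lia.
  - apply (key a j k); auto; lia.
Qed.
End FromThreeSquares.

Module ThreeSquares.
From mathcomp Require Import all_boot all_order all_algebra fingroup cyclic finfield.
From mathcomp Require Import realalg zify ring lra.
Set Implicit Arguments.
Unset Strict Implicit.
Unset Printing Implicit Defensive.
Import Order.TTheory GRing.Theory Num.Theory.
Local Open Scope ring_scope.

(** * Quadratic reciprocity *)

(* The Legendre symbol of [x] modulo [p]. *)
Definition quad (p : nat) (x : 'F_p) : int :=
  if x == 0 then 0 else if x ^+ p./2 == 1 then 1 else -1.

Lemma pchar_intr_eq0 (A : nzRingType) (q : nat) (k : int) :
  q \in [pchar A] -> (k%:~R == 0 :> A) = (q %| `|k|)%N.
Proof.
move=> qA; rewrite (dvdn_pcharf qA); case: k => n //=.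
by rewrite NegzE mulrNz oppr_eq0.
Qed.

Section Quad.
Variable p : nat.
Hypotheses (p_pr : prime p) (p_odd : odd p).

Lemma Fp_expf (x : 'F_p) : x != 0 -> x ^+ p.-1 = 1.
Proof.
move=> nz; have e : x ^+ p.-1.+1 = x.
  by rewrite prednK ?prime_gt0 //; have := expf_card x; rewrite card_Fp.
by apply: (mulfI nz); rewrite -exprS e mulr1.
Qed.

Lemma quadE (x : 'F_p) : (quad x)%:~R = x ^+ p./2.
Proof.
have p_gt1 := prime_gt1 p_pr.
rewrite /quad; have [->|nz] := eqVneq; first by rewrite expr0n; case: eqP => //; lia.
have [->//|n1] := eqVneq.
have /eqP := Fp_expf nz; have -> : p.-1 = (p./2 * 2)%N by lia.
by rewrite exprM sqrf_eq1 (negbTE n1) => /eqP ->; rewrite mulrNz.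
Qed.

Lemma quad_val (x : 'F_p) : [|| quad x == 0, quad x == 1 | quad x == -1].
Proof. by rewrite /quad; case: ifP => _ //; case: ifP. Qed.

Lemma quad_eq0 (x : 'F_p) : (quad x == 0) = (x == 0).
Proof. by rewrite /quad; case: ifP => // _; case: ifP. Qed.

(** Two such values differ by at most 2, and [p > 2]; identities between symbols can therefore be
    checked in ['F_p]. *)
Lemma sign_inj (a b : int) : [|| a == 0, a == 1 | a == -1] ->
  [|| b == 0, b == 1 | b == -1] -> a%:~R = b%:~R :> 'F_p -> a = b.
Proof.
move=> ha hb /eqP; rewrite -subr_eq0 -intrB (pchar_intr_eq0 _ (pchar_Fp p_pr)).
have p_gt2 : (2 < p)%N by have := prime_gt1 p_pr; lia.
by case/or3P: ha => /eqP-> ; case/or3P: hb => /eqP-> //= /dvdn_leq; lia.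
Qed.

Lemma quad1 : quad (1 : 'F_p) = 1.
Proof. by rewrite /quad oner_eq0 expr1n eqxx. Qed.

Lemma quadM : {morph @quad p : x y / x * y}.
Proof.
move=> x y; apply: sign_inj; rewrite ?quad_val //.
  by case/or3P: (quad_val x) => /eqP->; case/or3P: (quad_val y) => /eqP->.
by rewrite intrM !quadE exprMn.
Qed.

Lemma Fp_generator : exists2 g : 'F_p, g != 0 &
  (forall x, x != 0 -> exists k, x = g ^+ k) /\ (forall k, g ^+ k = 1 -> (p.-1 %| k)%N).
Proof.
have /cyclicP[g eg] := field_unit_group_cyclic [set: {unit 'F_p}].
have og : #[g]%g = p.-1 by rewrite orderE -eg card_finField_unit card_Fp.
exists (val g); first by rewrite -unitfE (valP g).
split=> [x nz | k e].
  have ux : x \is a GRing.unit by rewrite unitfE.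
  have: FinRing.unit 'F_p ux \in <[g]>%g by rewrite -eg inE.
  case/cycleP=> k ek; exists k; have /(congr1 val) /= := ek.
  by move=> ->; rewrite FinRing.val_unitX.
rewrite -og order_dvdn; apply/eqP/val_inj; by rewrite FinRing.val_unitX.
Qed.

(** For [x = g^k] with a generator [g], Euler's criterion makes [p - 1] divide [k (p - 1) / 2], so
    [k] is even. *)
Lemma quad1_sqr (x : 'F_p) : quad x = 1 -> exists y, x = y ^+ 2.
Proof.
move=> qx; have nz : x != 0 by rewrite -quad_eq0 qx.
have [g _ [gen ord]] := Fp_generator; have [k ek] := gen x nz.
have : x ^+ p./2 = 1 by rewrite -quadE qx.
rewrite ek -exprM => /ord => dv.
have /dvdnP[j ej] : (2 %| k)%N.
  have e : p.-1 = (2 * p./2)%N by lia.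
  by rewrite e dvdn_pmul2r // in dv; have := prime_gt1 p_pr; lia.
by exists (g ^+ j); rewrite -exprM -ej.
Qed.

Lemma quad_nonres : exists x : 'F_p, quad x = -1.
Proof.
have [g nz [_ ord]] := Fp_generator; exists g; rewrite /quad (negbTE nz); case: eqP => // /ord.
by have := prime_gt1 p_pr; move=> ? /dvdn_leq; lia.
Qed.

(** Multiplication by a nonresidue permutes the terms and negates the sum. *)
Lemma sum_quad : \sum_(x : 'F_p) quad x = 0.
Proof.
have [u qu] := quad_nonres; have nu : u != 0 by rewrite -quad_eq0 qu.
have : \sum_(x : 'F_p) quad x = - \sum_(x : 'F_p) quad x.
  rewrite [LHS](reindex_inj (mulfI nu)) -sumrN; apply: eq_bigr => x _.
  by rewrite quadM qu mulN1r.
by lia.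
Qed.

Lemma quadN1 : quad (-1 : 'F_p) = (-1) ^+ p./2.
Proof.
apply: sign_inj; first exact: quad_val.
  by rewrite -signr_odd; case: odd.
by rewrite quadE rmorphXn /= mulrNz.
Qed.

(* The Gauss sum [G] satisfies [G ^ 2 = P] with [P = (-1/p) p], and Frobenius gives [G ^ q = (q/p) G]. *)
Section GaussSum.
Variables (A : comNzRingType) (q : nat) (z : A).
Hypotheses (q_odd : odd q) (qA : q \in [pchar A]) (neq_qp : q%:R != 0 :> 'F_p).
Hypotheses (zp : z ^+ p = 1) (sum_z : \sum_(i < p) z ^+ i = 0).

Let e (x : 'F_p) : A := z ^+ x.

Let eE k : e k%:R = z ^+ k.
Proof. by rewrite /e val_Fp_nat // expr_mod. Qed.

Let eD x y : e (x + y) = e x * e y.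
Proof. by rewrite -[x]natr_Zp -[y]natr_Zp -natrD !eE exprD. Qed.

Let e0 : e 0 = 1.
Proof. exact: expr0. Qed.

Let eX x k : e x ^+ k = e (k%:R * x).
Proof.
elim: k => [|k IH]; first by rewrite mul0r e0.
by rewrite exprS IH -eD mulrSr mulrDl mul1r addrC.
Qed.

Let sum_e : \sum_(x : 'F_p) e x = 0.
Proof.
by rewrite -[RHS]sum_z -!(big_mkord xpredT (fun i => z ^+ i)) Fp_cast.
Qed.

Let sum_e_nz (y : 'F_p) : \sum_(x | x != 0) e (x * y) = (if y == 0 then p%:R else 0) - 1.
Proof.
have -> : (if y == 0 then p%:R else 0) = \sum_x e (x * y).
  case: eqVneq => [->|ny]; last by rewrite -[LHS]sum_e [LHS](reindex_inj (mulIf ny)).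
  rewrite (eq_bigr (fun _ => 1)) => [|x _]; last by rewrite mulr0 e0.
  by rewrite sumr_const card_Fp.
by rewrite [X in _ = X - 1](bigD1 0) //= mul0r e0 addrAC subrr add0r.
Qed.

Let G : A := \sum_x (quad x)%:~R * e x.

(** Substituting [x y] for the second variable leaves [quad y] times a sum of [e (x (1 + y))] over
    [x != 0]. By orthogonality only [y = -1] contributes [p]; the remaining terms add up to zero by
    [sum_quad]. *)
Let G2 : G ^+ 2 = (quad (-1 : 'F_p) * p%:Z)%:~R.
Proof.
rewrite expr2 {1}/G mulr_suml.
transitivity (\sum_(y : 'F_p) (quad y)%:~R * \sum_(x : 'F_p | x != 0) e (x * (1 + y))).
  under [RHS]eq_bigr do rewrite mulr_sumr.
  rewrite [RHS]exchange_big /= (bigID (fun x => x != 0)) /= [X in _ + X]big1 ?addr0; last first.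
    by move=> x /negPn/eqP ->; rewrite /quad eqxx !mul0r.
  apply: eq_bigr => x nx; rewrite /G mulr_sumr (reindex_inj (mulfI nx)) /=.
  apply: eq_bigr => y _; rewrite mulrACA -intrM -eD mulrDr mulr1; congr (_%:~R * _).
  rewrite quadM mulrA; case/or3P: (quad_val x) nx => /eqP qx; rewrite qx ?mul1r //.
  by move/eqP: qx; rewrite quad_eq0 => ->.
under eq_bigr do rewrite sum_e_nz mulrBr mulr1.
rewrite sumrB -rmorph_sum sum_quad subr0 (bigD1 (-1)) //= addrC big1; last first.
  by move=> y ny; rewrite addrC addr_eq0 (negbTE ny) mulr0.
by rewrite addrC addrC add0r subrr eqxx intrM.
Qed.

Let GX : G ^+ q = (quad (q%:R : 'F_p))%:~R * G.
Proof.
rewrite -(pFrobenius_autE qA) /G rmorph_sum mulr_sumr.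
rewrite [RHS](reindex_inj (mulfI neq_qp)); apply: eq_bigr => x _ /=.
rewrite rmorphM /= rmorph_int !pFrobenius_autE eX mulrA -intrM quadM mulrA.
congr (_%:~R * _); case/or3P: (quad_val (q%:R : 'F_p)) => /eqP qx; rewrite qx ?mul1r ?mulr1 //.
  by move/eqP: qx; rewrite quad_eq0 (negbTE neq_qp).
Qed.

(** Comparing the two values of [G^q] gives an equation with a factor [G]. It is multiplied by [G]
    once more rather than cancelled, so that only integers remain. *)
Lemma gauss_sum_identity (P := quad (-1 : 'F_p) * p%:Z) :
  (P * (P ^+ q./2 - quad (q%:R : 'F_p)))%:~R = 0 :> A.
Proof.
have eG : G * (G ^+ 2) ^+ q./2 = (quad (q%:R : 'F_p))%:~R * G.
  by rewrite -exprM -exprS -GX; congr (_ ^+ _); lia.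
rewrite intrM intrB rmorphXn /= -G2 [in X in X * _]expr2 -mulrA mulrBr eG.
by rewrite [G * _%:~R]mulrC subrr mulr0.
Qed.
End GaussSum.

End Quad.

Lemma qpoly_char (F : comNzRingType) (h : {poly F}) (q : nat) :
  q \in [pchar F] -> q \in [pchar {poly %/ h}].
Proof.
move=> /andP[q_pr /eqP q0]; apply/andP; split=> //; apply/eqP.
have -> : q%:R = in_qpoly h (q%:R) by rewrite rmorph_nat.
by rewrite -polyC_natr q0 in_qpoly0.
Qed.

Section QuadraticReciprocity.
Variables (p q : nat).
Hypotheses (p_pr : prime p) (p_odd : odd p) (q_pr : prime q) (q_odd : odd q).

(** The Gauss sum is taken in the quotient of ['F_q[X]] by [1 + X + ... + X^(p-1)], with [z] the
    class of [X]. An integer that vanishes there is divisible by [q], and the factor [P], equal to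
    [p] up to sign, is not. *)
Theorem quad_reciprocity : p != q ->
  (quad (q%:R : 'F_p))%:~R = (quad (-1 : 'F_p) * p%:Z)%:~R ^+ q./2 :> 'F_q.
Proof.
move=> neq; have qF := pchar_Fp q_pr; have p_gt1 := prime_gt1 p_pr.
have neq_qp : q%:R != 0 :> 'F_p.
  by rewrite -(dvdn_pcharf (pchar_Fp p_pr)) dvdn_prime2.
pose h : {poly 'F_q} := \poly_(i < p) 1.
have size_h : size h = p by rewrite size_poly_eq ?oner_eq0.
have h_monic : h \is monic by rewrite monicE lead_coef_poly ?oner_eq0 //; lia.
have hE : h = \sum_(i < p) 'X^i by rewrite /h poly_def; apply: eq_bigr => i _; rewrite scale1r.
have mk_h : mk_monic h = h by rewrite /mk_monic size_h p_gt1 h_monic.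
have h0 : in_qpoly h h = 0.
  by apply/val_inj; rewrite /= mk_h Pdiv.RingMonic.rmodpp.
pose z := in_qpoly h 'X.
have sum_z : \sum_(i < p) z ^+ i = 0.
  transitivity (in_qpoly h (\sum_(i < p) 'X^i)); last by rewrite -hE h0.
  by rewrite rmorph_sum; apply: eq_bigr => i _; rewrite rmorphXn.
have zp : z ^+ p = 1.
  by apply/eqP; rewrite -subr_eq0 subrX1 sum_z mulr0.
have := gauss_sum_identity p_pr p_odd q_odd (qpoly_char h qF) neq_qp zp sum_z.
set P := quad (-1 : 'F_p) * p%:Z => /eqP; rewrite (pchar_intr_eq0 _ (qpoly_char h qF)).
rewrite -(pchar_intr_eq0 _ qF) intrM mulf_eq0 => /orP[|]; last first.
  by rewrite intrB subr_eq0 rmorphXn => /eqP ->.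
rewrite (pchar_intr_eq0 _ qF) abszM Euclid_dvdM //= [(q %| p)%N]dvdn_prime2 // [q == p]eq_sym (negbTE neq) orbF.
by rewrite (quadN1 p_pr p_odd) abszX exp1n dvdn1 => /eqP q1; move: q_pr; rewrite q1.
Qed.
End QuadraticReciprocity.

(* For odd [n], [chi4 n] is the Jacobi symbol (-1/n) and [chi8 n] is (2/n). *)
Definition chi4 (n : nat) : int := nth 0 [:: 0; 1; 0; -1; 0; 1; 0; -1] (n %% 8).

Definition chi8 (n : nat) : int := nth 0 [:: 0; 1; 0; -1; 0; -1; 0; 1] (n %% 8).

(** The same argument modulo [X^4 + 1], where [z] is an eighth root of unity and
    [t = z - z^3 = z + 1/z] has square 2; [t^q] depends only on [q] modulo 8. *)
Theorem quad_two (q : nat) (q_pr : prime q) (q_odd : odd q) :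
  2%:R ^+ q./2 = (chi8 q)%:~R :> 'F_q.
Proof.
have qF := pchar_Fp q_pr.
pose h : {poly 'F_q} := 'X^4 + 1%:P.
have size_h : size h = 5 by rewrite size_XnaddC.
have h_monic : h \is monic by rewrite monicXnaddC.
have mk_h : mk_monic h = h by rewrite /mk_monic size_h h_monic.
have h0 : in_qpoly h h = 0.
  by apply/val_inj; rewrite /= mk_h Pdiv.RingMonic.rmodpp.
pose z := in_qpoly h 'X.
have z4 : z ^+ 4 = -1.
  by apply/eqP; rewrite -addr_eq0 -h0 rmorphD rmorphXn rmorph1.
have qA := qpoly_char h qF.
pose t := z - z ^+ 3.
have t2 : t ^+ 2 = 2%:R.
  have -> : t ^+ 2 = z ^+ 2 - 2%:R * z ^+ 4 + z ^+ 4 * z ^+ 2 by rewrite /t; ring.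
  by rewrite z4; ring.
have tq : t ^+ q = (chi8 q)%:~R * t.
  rewrite -(pFrobenius_autE qA) /t rmorphB rmorphXn /= !pFrobenius_autE.
  have zm k : z ^+ k = z ^+ (k %% 8).
    by rewrite {1}(divn_eq k 8) exprD mulnC (exprM z 8) (exprM z 4 2) z4 sqrrN !expr1n mul1r.
  have q8 : (q %% 8 = 1 \/ q %% 8 = 3 \/ q %% 8 = 5 \/ q %% 8 = 7)%N by lia.
  case: q8 => [|[|[|]]] q8; rewrite (zm q) /chi8 q8 /=; rewrite ?mulrNz ?mul1r ?mulN1r ?expr1 //.
  - have -> : (z ^+ 3) ^+ 3 = z * (z ^+ 4) ^+ 2 by ring.
    by rewrite z4; ring.
  - have -> : (z ^+ 5) ^+ 3 = z ^+ 3 * (z ^+ 4) ^+ 3 by ring.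
    by rewrite [z ^+ 5]exprSr z4; ring.
  - have -> : (z ^+ 7) ^+ 3 = z * (z ^+ 4) ^+ 5 by ring.
    by rewrite [z ^+ 7](exprD z 4 3) z4; ring.
have : (2%:R * (2%:R ^+ q./2 - chi8 q))%:~R = 0 :> {poly %/ h}.
  have eT : t * (t ^+ 2) ^+ q./2 = (chi8 q)%:~R * t.
    by rewrite -exprM -exprS -tq; congr (_ ^+ _); lia.
  rewrite intrM intrB rmorphXn /= -[2%:~R]/(2%:R) -t2 [in X in X * _]expr2 -mulrA mulrBr eT.
  by rewrite [t * _%:~R]mulrC subrr mulr0.
move=> /eqP; rewrite (pchar_intr_eq0 _ qA) -(pchar_intr_eq0 _ qF) intrM mulf_eq0 => /orP[|].
  by rewrite (pchar_intr_eq0 _ qF) => /dvdn_leq; have := prime_gt1 q_pr; lia.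
by rewrite intrB subr_eq0 rmorphXn => /eqP ->.
Qed.

(** * Sums with weight [1 / sqrt n] *)

Lemma sum_dvdn_reindex (V : nmodType) (G : nat -> V) m Y : (0 < m)%N ->
  \sum_(1 <= n < Y.+1 | (m %| n)%N) G (n %/ m)%N
  = \sum_(1 <= k < Y.+1 | (m * k <= Y)%N) G k.
Proof.
move=> m0.
transitivity (\sum_(1 <= n < Y.+1) \sum_(1 <= k < Y.+1 | (n == m * k)%N) G k).
  rewrite big_mkcond /=; apply: eq_big_nat => n /andP[n1 nY]; case: ifP => [/dvdnP[k ek]|nd].
    rewrite ek mulnK // (eq_bigl (fun i => i == k)); last by move=> i /=; apply/eqP/eqP; nia.
    by rewrite big_nat1_eq; case: ifP => //; nia.
  by rewrite big1 // => i /eqP e; rewrite e dvdn_mulr in nd.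
rewrite (exchange_big_dep xpredT) //= [RHS]big_mkcond /=; apply: eq_big_nat => k /andP[k1 kY].
by rewrite big_nat1_eq; case: ifP; case: ifP => //; nia.
Qed.

Section Sums.
Variable R : rcfType.
Implicit Types f g u c : nat -> R.

(** Summation by parts; the factor 2 arises because a sum from [m] is a difference of two sums from
    0. *)
Lemma abel_bound f u (C : R) m k :
  (forall n, `|\sum_(0 <= i < n) f i| <= C) ->
  (forall n, (m <= n)%N -> 0 <= u n.+1 <= u n) -> 0 <= u m -> (m <= k)%N ->
  `|\sum_(m <= i < k) f i * u i| <= 2 * C * u m.
Proof.
move=> fC um um0 mk; pose S n := \sum_(m <= i < n) f i.
have SC n : (m <= n)%N -> `|S n| <= 2 * C.
  move=> mn; have -> : S n = \sum_(0 <= i < n) f i - \sum_(0 <= i < m) f i.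
    by rewrite (big_cat_nat (n := m)) //= addrAC subrr add0r.
  by apply: le_trans (ler_normB _ _) _; rewrite mulr_natl mulr2n lerD.
(* Once the boundary term is subtracted, the error bound telescopes and can be proved by
   induction. *)
suff H j : `|\sum_(m <= i < m + j) f i * u i - S (m + j)%N * u (m + j)%N|
    <= 2 * C * (u m - u (m + j)%N) /\ 0 <= u (m + j)%N.
  have [] := H (k - m)%N; rewrite subnKC // => h uk.
  rewrite -[X in `|X|](subrK (S k * u k)); apply: le_trans (ler_normD _ _) _.
  have : `|S k * u k| <= 2 * C * u k by rewrite normrM (ger0_norm uk) ler_wpM2r // SC.
  by lra.
elim: j => [|j [IH u0]]; first by rewrite addn0 /S !big_geq // mul0r !subrr normr0 mulr0.
have /andP[u1 u2] := um (m + j)%N (leq_addr _ _).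
rewrite addnS; split=> //; have mj : (m <= m + j)%N by rewrite leq_addr.
rewrite big_nat_recr //=.
have -> : S (m + j).+1 = S (m + j)%N + f (m + j)%N by rewrite /S big_nat_recr.
set T := \sum_(m <= i < m + j) _ in IH *.
have SC' := SC (m + j).+1 (leqW mj); rewrite /S big_nat_recr //= -/(S _) in SC'.
have -> : T + f (m + j)%N * u (m + j)%N - (S (m + j)%N + f (m + j)%N) * u (m + j).+1
  = (T - S (m + j)%N * u (m + j)%N) + (S (m + j)%N + f (m + j)%N) * (u (m + j)%N - u (m + j).+1) by ring.
apply: le_trans (ler_normD _ _) _.
have : `|(S (m + j)%N + f (m + j)%N) * (u (m + j)%N - u (m + j).+1)| <= 2 * C * (u (m + j)%N - u (m + j).+1).
  by rewrite normrM (ger0_norm (x := u _ - _)) ?subr_ge0 // ler_wpM2r // subr_ge0.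
by lra.
Qed.

(* Chosen because it is completely multiplicative, with [wt (m ^ 2) = 1 / m]. *)
Definition wt (n : nat) : R := (Num.sqrt n%:R)^-1.

Lemma wt_ge0 n : 0 <= wt n. Proof. by rewrite invr_ge0 sqrtr_ge0. Qed.

Lemma wtM m n : wt (m * n) = wt m * wt n.
Proof. by rewrite /wt natrM sqrtrM ?ler0n // invfM. Qed.

Lemma wt_sqr m : wt (m * m) = m%:R^-1.
Proof. by rewrite /wt natrM -expr2 sqrtr_sqr normr_nat. Qed.

Lemma sqrt_gt0 n : (0 < n)%N -> 0 < Num.sqrt (n%:R : R).
Proof. by move=> n0; rewrite sqrtr_gt0 ltr0n. Qed.

Lemma wt_le m n : (0 < m)%N -> (m <= n)%N -> wt n <= wt m.
Proof.
move=> m0 mn; rewrite /wt lef_pV2 ?qualifE /= ?sqrt_gt0 //; last by lia.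
by rewrite ler_sqrt ?ler0n // ler_nat.
Qed.

Lemma sum_wt_le X : \sum_(1 <= m < X.+1) wt m <= 2 * Num.sqrt X%:R.
Proof.
elim: X => [|X IH]; first by rewrite big_geq // sqrtr0 mulr0.
rewrite big_nat_recr //=.
suff : wt X.+1 <= 2 * (Num.sqrt X.+1%:R - Num.sqrt X%:R) by lra.
have s1 : 0 < Num.sqrt (X.+1%:R : R) by rewrite sqrt_gt0.
have s0 : 0 <= Num.sqrt (X%:R : R) by rewrite sqrtr_ge0.
rewrite /wt -[X in X <= _]mul1r ler_pdivrMr //.
have e1 : Num.sqrt (X.+1%:R : R) ^+ 2 = X%:R + 1 by rewrite sqr_sqrtr ?ler0n // -natr1.
have e0 : Num.sqrt (X%:R : R) ^+ 2 = X%:R by rewrite sqr_sqrtr ?ler0n.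
nra.
Qed.

Lemma sum_divisors_pairs (F : nat -> nat -> R) Y :
  \sum_(1 <= n < Y.+1) \sum_(1 <= m < n.+1 | (m %| n)%N) F m (n %/ m)%N
  = \sum_(1 <= m < Y.+1) \sum_(1 <= k < Y.+1 | (m * k <= Y)%N) F m k.
Proof.
transitivity (\sum_(1 <= n < Y.+1) \sum_(1 <= m < Y.+1 | (m %| n)%N) F m (n %/ m)%N).
  apply: eq_big_nat => n /andP[n1 nY].
  rewrite [RHS](big_cat_nat (n := n.+1)) //= [X in _ = _ + X]big_nat_cond.
  rewrite [X in _ = _ + X]big1 ?addr0 // => i /andP[/andP[i1 i2]] /dvdn_leq; lia.
rewrite (exchange_big_dep xpredT) //=; apply: eq_big_nat => m /andP[m1 _].
by rewrite sum_dvdn_reindex.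
Qed.

(** The region [m <= X < k] of the hyperbola. For fixed [m], Abel summation bounds the sum over [k]
    by [2 C / sqrt X], and the weights of [m] add up to at most [2 sqrt X]. *)
Lemma hyperbola_half f g (C : R) X :
  (forall n, `|f n| <= 1) ->
  (forall n, `|\sum_(0 <= i < n) g i| <= C) ->
  `|\sum_(1 <= m < X.+1) \sum_(X.+1 <= k < (X * X).+1 | (m * k <= X * X)%N) f m * g k * wt (m * k)|
   <= 4 * C.
Proof.
move=> f1 gC; have C0 : 0 <= C by apply: le_trans (gC 0%N).
case: (posnP X) => [->|X0]; first by rewrite big_geq // normr0; lra.
apply: le_trans (ler_norm_sum _ _ _) _.
apply: (@le_trans _ _ (\sum_(1 <= m < X.+1) wt m * (2 * C * wt X))).
  apply: ler_sum_nat => m /andP[m1 mX].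
  have le1 : (X.+1 <= (X * X %/ m).+1)%N by rewrite ltnS leq_divRL //; nia.
  have -> : \sum_(X.+1 <= k < (X * X).+1 | (m * k <= X * X)%N) f m * g k * wt (m * k)
    = f m * wt m * \sum_(X.+1 <= k < (X * X %/ m).+1) g k * wt k.
    have le2 : (X * X %/ m < (X * X).+1)%N by rewrite ltnS leq_div.
    rewrite (big_cat_nat (n := (X * X %/ m).+1)) //= [X in _ + X]big_nat_cond [X in _ + X]big1 ?addr0; last first.
      by move=> k /andP[/andP[]]; rewrite ltn_divLR //; nia.
    rewrite mulr_sumr big_nat_cond [RHS]big_nat_cond; apply: eq_big => [k|k _]; last by rewrite wtM; ring.
    by case: (_ <= k < _)%N / andP => //= -[_]; rewrite ltnS leq_divRL // mulnC => ->.
  rewrite normrM; apply: ler_pM => //.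
    by rewrite normrM (ger0_norm (wt_ge0 _)) ler_piMl ?wt_ge0.
  apply: le_trans (abel_bound gC _ (wt_ge0 _) le1) _.
    by move=> n nX; rewrite wt_ge0 wt_le //; lia.
  by rewrite ler_wpM2l ?wt_le //; lra.
rewrite -mulr_suml.
have s := sum_wt_le X; have w0 := wt_ge0 X.
have e : Num.sqrt X%:R * wt X = 1 by rewrite /wt mulfV // gt_eqF ?sqrt_gt0.
have : (\sum_(1 <= m < X.+1) wt m) * (2 * C * wt X) <= 2 * Num.sqrt X%:R * (2 * C * wt X).
  by rewrite ler_wpM2r // mulr_ge0 //; lra.
have -> : 2 * Num.sqrt X%:R * (2 * C * wt X) = 4 * C * (Num.sqrt X%:R * wt X) by ring.
by rewrite e mulr1.
Qed.

(** The pairs with [m k <= X^2] split into the square [m, k <= X], a product of two sums bounded by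
    [2 C], and two regions bounded by [hyperbola_half]. *)
Lemma hyperbola f g (C : R) X :
  (forall n, `|f n| <= 1) -> (forall n, `|g n| <= 1) ->
  (forall n, `|\sum_(0 <= i < n) f i| <= C) ->
  (forall n, `|\sum_(0 <= i < n) g i| <= C) ->
  `|\sum_(1 <= n < (X * X).+1)
      (\sum_(1 <= m < n.+1 | (m %| n)%N) f m * g (n %/ m)%N) * wt n| <= 4 * C ^+ 2 + 8 * C.
Proof.
move=> f1 g1 fC gC.
have -> : \sum_(1 <= n < (X * X).+1) (\sum_(1 <= m < n.+1 | (m %| n)%N) f m * g (n %/ m)%N) * wt n
  = \sum_(1 <= m < (X * X).+1) \sum_(1 <= k < (X * X).+1 | (m * k <= X * X)%N) f m * g k * wt (m * k).
  rewrite -(sum_divisors_pairs (fun m k => f m * g k * wt (m * k))).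
  apply: eq_big_nat => n _; rewrite mulr_suml; apply: eq_bigr => m mn.
  by rewrite [(m * _)%N]mulnC divnK.
have XY : (X.+1 <= (X * X).+1)%N by nia.
rewrite (big_cat_nat (n := X.+1)) //=.
have -> : \sum_(1 <= m < X.+1) \sum_(1 <= k < (X * X).+1 | (m * k <= X * X)%N) f m * g k * wt (m * k)
 = (\sum_(1 <= m < X.+1) f m * wt m) * (\sum_(1 <= k < X.+1) g k * wt k)
  + \sum_(1 <= m < X.+1) \sum_(X.+1 <= k < (X * X).+1 | (m * k <= X * X)%N) f m * g k * wt (m * k).
  rewrite mulr_suml -big_split; apply: eq_big_nat => m /andP[m1 mX] /=.
  rewrite (big_cat_nat (n := X.+1)) //=; congr (_ + _); rewrite mulr_sumr big_nat_cond [RHS]big_nat_cond.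
  apply: eq_big => [k|k _]; last by rewrite wtM; ring.
  by case: (_ <= k < _)%N / andP => //= -[k1 kX]; rewrite leq_mul.
have -> : \sum_(X.+1 <= m < (X * X).+1) \sum_(1 <= k < (X * X).+1 | (m * k <= X * X)%N) f m * g k * wt (m * k)
 = \sum_(1 <= k < X.+1) \sum_(X.+1 <= m < (X * X).+1 | (k * m <= X * X)%N) g k * f m * wt (k * m).
  rewrite (exchange_big_dep xpredT) //= (big_cat_nat (n := X.+1)) //= [X in _ + X]big_nat_cond [X in _ + X]big1 ?addr0.
    by apply: eq_bigr => k _; apply: eq_big => [m|m _]; rewrite mulnC // [f m * _]mulrC.
  move=> k /andP[/andP[k1 _] _]; rewrite big_nat_cond big1 // => m /andP[/andP[m1 _]]; nia.
have h1 := hyperbola_half X f1 gC; have h2 := hyperbola_half X g1 fC.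
have C0 : 0 <= C by apply: le_trans (gC 0%N).
have hA (F : nat -> R) : (forall n, `|\sum_(0 <= i < n) F i| <= C) -> `|\sum_(1 <= m < X.+1) F m * wt m| <= 2 * C.
  move=> FC; apply: le_trans (abel_bound FC _ (wt_ge0 _) _) _ => // [n n1|].
    by rewrite wt_ge0 wt_le.
  by rewrite /wt sqrtr1 invr1 mulr1.
have := hA _ fC; have := hA _ gC.
move: (\sum_(1 <= m < X.+1) g m * wt m) (\sum_(1 <= m < X.+1) f m * wt m) => a b ha hb.
have : `|b * a| <= 2 * C * (2 * C) by rewrite normrM ler_pM.
move=> hab; apply: le_trans (ler_normD _ _) _; apply: le_trans (lerD (ler_normD _ _) (lexx _)) _.
by rewrite expr2; lra.
Qed.

(** Each dyadic block contributes at least 1/2. *)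
Lemma harmonic_pow2 k : k%:R / 2 <= \sum_(0 <= j < 2 ^ k) j.+1%:R^-1 :> R.
Proof.
elim: k => [|k IH]; first by rewrite big_nat1 mul0r invr_ge0 ler0n.
rewrite (big_cat_nat (n := (2 ^ k)%N)) //=; last by rewrite leq_exp2l.
suff : 1 / 2 <= \sum_(2 ^ k <= i < 2 ^ k.+1) i.+1%:R^-1 :> R by rewrite -[k.+1%:R]natr1; lra.
have -> : 1 / 2 = \sum_(2 ^ k <= i < 2 ^ k.+1) (2 ^ k.+1)%:R^-1 :> R.
  rewrite sumr_const_nat expnS mul2n -addnn addnK addnn -mul2n natrM -mulr_natr.
  by field; rewrite natrX expf_neq0 // pnatr_eq0.
apply: ler_sum_nat => i /andP[i1 i2]; rewrite lef_pV2 ?qualifE /= ?ltr0n ?expn_gt0 // ler_nat //.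
Qed.

(** Only the terms [n = m^2] with [m = q j + 1] are kept; their weight is
    [1 / m >= 1 / (q (j + 1))], which leaves a harmonic sum divided by [q]. *)
Lemma sum_wt_unbounded c (q : nat) k : (0 < q)%N ->
  (forall n, 0 <= c n) -> (forall m, (m = 1 %[mod q])%N -> (0 < m)%N -> 1 <= c (m * m)%N) ->
  k%:R / 2 / q%:R <= \sum_(1 <= n < ((q * 2 ^ k) * (q * 2 ^ k)).+1) c n * wt n.
Proof.
move=> q0 c0 c1; pose S Y := \sum_(1 <= n < Y.+1) c n * wt n.
have Smono Y Z : (Y <= Z)%N -> S Y <= S Z.
  move=> YZ; rewrite /S (big_cat_nat (n := Y.+1) (p := Z.+1)) //= lerDl sumr_ge0 // => i _.
  by rewrite mulr_ge0 ?wt_ge0.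
have step j : S (q * j * (q * j))%N + (q * j.+1)%:R^-1 <= S (q * j.+1 * (q * j.+1))%N.
  have h1 : S (q * j * (q * j))%N + c ((q * j).+1 * (q * j).+1)%N * wt ((q * j).+1 * (q * j).+1)
     <= S ((q * j).+1 * (q * j).+1)%N.
    have [N eN] : exists N, ((q * j).+1 * (q * j).+1 = N.+1)%N by exists ((q * j).+1 * (q * j).+1).-1.
    rewrite eN [X in _ <= X]/S big_nat_recr //= lerD2r; apply: Smono; nia.
  apply: le_trans (le_trans h1 _); last by apply: Smono; nia.
  rewrite lerD2l wt_sqr.
  have : (q * j.+1)%:R^-1 <= (q * j).+1%:R^-1 :> R by rewrite lef_pV2 ?qualifE /= ?ltr0n ?ler_nat //; nia.
  move=> h; apply: le_trans h _; rewrite ler_peMl ?invr_ge0 ?ler0n // c1 //.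
  by rewrite -addn1 mulnC modnMDl.
have H j : q%:R^-1 * (\sum_(0 <= i < j) i.+1%:R^-1) <= S (q * j * (q * j))%N.
  elim: j => [|j IH]; first by rewrite big_geq // mulr0 sumr_ge0 // => i _; rewrite mulr_ge0 ?wt_ge0.
  by apply: le_trans (step j); rewrite big_nat_recr //= mulrDr natrM invfM lerD2r.
by apply: le_trans (H _); rewrite mulrC ler_wpM2l ?invr_ge0 ?ler0n // harmonic_pow2.
Qed.
End Sums.

(** * Quadratic characters *)

Section PeriodicCharacter.
Variables (Q : nat) (f : nat -> int).
Hypotheses (Q_gt0 : (0 < Q)%N) (f_mod : forall n, f (n %% Q)%N = f n) (f_le1 : forall n, `|f n| <= 1).
Hypothesis (fM : forall m n, f (m * n)%N = f m * f n).
Variable u : nat.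
Hypotheses (u_coprime : coprime u Q) (fu : f u = -1).

(** Multiplication by [u] permutes the residues modulo [Q] and negates [f]. *)
Lemma char_sum_period : \sum_(0 <= i < Q) f i = 0.
Proof.
have modQ i : (u * i %% Q < Q)%N by rewrite ltn_mod.
pose h (i : 'I_Q) : 'I_Q := Ordinal (modQ i).
have h_inj : injective h.
  move=> i j /(congr1 val) /= /eqP.
  wlog le_ij : i j / (j <= i)%N => [H e|].
    by case: (leqP j i) => [|/ltnW] le_ij; [|symmetry]; apply: H => //; rewrite eq_sym.
  rewrite eqn_mod_dvd ?leq_mul2l ?le_ij ?orbT // -mulnBr Gauss_dvdr 1?coprime_sym //.
  move=> d; apply/val_inj => /=; case: (posnP (i - j)%N) => [|p]; first lia.
  by have := dvdn_leq p d; have := ltn_ord i; lia.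
suff : \sum_(0 <= i < Q) f i = - \sum_(0 <= i < Q) f i by lia.
rewrite big_mkord [LHS](reindex_inj h_inj) -sumrN; apply: eq_bigr => i _ /=.
by rewrite f_mod fM fu mulN1r.
Qed.

Lemma char_sum_bound n : `|\sum_(0 <= i < n) f i| <= Q%:Z.
Proof.
elim/ltn_ind: n => n IH; case: (leqP Q n) => [Qn|/ltnW nQ].
  rewrite (big_cat_nat (n := Q)) //= char_sum_period add0r -[X in \sum_(X <= _ < _) _]add0n big_addn.
  rewrite (eq_bigr f) => [|i _]; last by rewrite -f_mod modnDr f_mod.
  by apply: IH; lia.
apply: le_trans (ler_norm_sum _ _ _) _; apply: le_trans (ler_sum _ (fun i _ => f_le1 i)) _.
by rewrite sumr_const_nat subn0 natz lez_nat.
Qed.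
End PeriodicCharacter.

Lemma natr_Fp_eq_mod p m n : prime p -> m = n %[mod p] -> m%:R = n%:R :> 'F_p.
Proof. by move=> pp e; rewrite -Fp_nat_mod // e Fp_nat_mod. Qed.

Lemma eq_mod_dvd d q m n : (d %| q)%N -> m = n %[mod q] -> m = n %[mod d].
Proof. by move=> dq e; rewrite -(modn_dvdm m dq) e modn_dvdm. Qed.

Section Psi.
Implicit Types (D : seq nat) (n : nat).

(* The Jacobi symbol of [n] modulo the product of [D]. *)
Definition psi D n : int := \prod_(p <- D) quad (n%:R : 'F_p).

Lemma psi_cons p D n : psi (p :: D) n = quad (n%:R : 'F_p) * psi D n.
Proof. by rewrite /psi big_cons. Qed.

Definition odd_primes D := all prime D && all odd D.

Lemma odd_primes_cons p D : odd_primes (p :: D) = [&& prime p, odd p & odd_primes D].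
Proof. by rewrite /odd_primes /= -!andbA; congr (_ && _); rewrite andbCA. Qed.

Lemma prod_odd_primes_gt0 D : odd_primes D -> (0 < \prod_(p <- D) p)%N.
Proof.
elim: D => [|p D IH]; first by rewrite big_nil.
by rewrite odd_primes_cons big_cons muln_gt0 => /and3P[pp _ /IH->]; rewrite prime_gt0.
Qed.

Lemma psiM D m n : odd_primes D -> psi D (m * n) = psi D m * psi D n.
Proof.
elim: D => [|p D IH]; first by rewrite /psi !big_nil.
by rewrite odd_primes_cons !psi_cons => /and3P[pp po /IH->]; rewrite natrM quadM // mulrACA.
Qed.

Lemma psi1 D : odd_primes D -> psi D 1 = 1.
Proof.
elim: D => [|p D IH]; first by rewrite /psi !big_nil.
by rewrite odd_primes_cons !psi_cons => /and3P[pp po /IH->]; rewrite quad1.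
Qed.

Lemma psi_congr D m n : odd_primes D -> m = n %[mod \prod_(p <- D) p] -> psi D m = psi D n.
Proof.
elim: D => [|p D IH]; first by rewrite /psi !big_nil.
rewrite odd_primes_cons !psi_cons big_cons => /and3P[pp po /IH IHD] e.
have ep := eq_mod_dvd (dvdn_mulr (\prod_(j <- D) j) (dvdnn p)) e.
by rewrite (natr_Fp_eq_mod pp ep) IHD // (eq_mod_dvd _ e) // dvdn_mull.
Qed.

Lemma psi_val D n : [|| psi D n == 0, psi D n == 1 | psi D n == -1].
Proof.
elim: D => [|p D IH]; first by rewrite /psi !big_nil.
rewrite psi_cons; case/or3P: IH => /eqP->; rewrite ?mulr0 ?mulr1 ?mulrN1 //.
  exact: quad_val.
by case/or3P: (quad_val (n%:R : 'F_p)) => /eqP->.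
Qed.

Lemma psi_eq0 D n : odd_primes D -> (psi D n == 0) = ~~ coprime n (\prod_(p <- D) p).
Proof.
elim: D => [|p D IH]; first by rewrite /psi !big_nil coprimen1.
rewrite odd_primes_cons psi_cons big_cons coprimeMr mulf_eq0 negb_and => /and3P[pp po /IH->].
by rewrite quad_eq0 -(dvdn_pcharf (pchar_Fp pp)) [coprime n p]coprime_sym (prime_coprime _ pp) negbK.
Qed.

Lemma psi_perm D D' n : perm_eq D D' -> psi D n = psi D' n.
Proof. exact: perm_big. Qed.
End Psi.

Lemma coprime_prod_primes p D : prime p -> all prime D -> p \notin D -> coprime p (\prod_(j <- D) j).
Proof.
move=> pp; elim: D => [|j D IH]; first by rewrite big_nil coprimen1.
rewrite /= inE negb_or big_cons coprimeMr => /andP[pj aD] /andP[npj /(IH aD) ->].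
by rewrite prime_coprime // dvdn_prime2 // npj.
Qed.

(** The nontrivial real characters modulo 8. They provide the part of (-N/n) at the prime 2: [chi4]
    for odd [N], [chi8] for [N = 6] modulo 8. *)
Record char8 (kap : nat -> int) : Prop := Char8 {
  char8M : forall m n, kap (m * n)%N = kap m * kap n;
  char8_mod : forall n, kap (n %% 8)%N = kap n;
  char8_val : forall n, [|| kap n == 0, kap n == 1 | kap n == -1];
  char8_1 : kap 1 = 1;
  char8_eq0 : forall n, (kap n == 0) = ~~ odd n;
  char8_N1 : exists u, kap u = -1
}.

Section RepresentedIntegers.
Variable kap : nat -> int.
Hypothesis kapP : char8 kap.
Let kapM := char8M kapP.
Let kap_mod := char8_mod kapP.
Let kap_val := char8_val kapP.
Let kap1 := char8_1 kapP.
Let kap_eq0 := char8_eq0 kapP.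
Variable ps : seq nat.
Hypotheses (ps_odd : odd_primes ps) (ps_uniq : uniq ps).

Let M := (\prod_(p <- ps) p)%N.
Let Q := (8 * M)%N.

(** By reciprocity this is the symbol (-N/n) at odd primes [n] outside [ps], as soon as [-N] is the
    matching product of [pstar p] and -1 or 2. *)
Definition chi n : int := kap n * psi ps n.

Let M_odd : odd M.
Proof.
rewrite /M; elim: ps ps_odd => [|p D IH]; first by rewrite big_nil.
by rewrite odd_primes_cons big_cons oddM => /and3P[_ -> /IH].
Qed.

Let Q_gt0 : (0 < Q)%N. Proof. by rewrite muln_gt0 prod_odd_primes_gt0. Qed.

Lemma chiM m n : chi (m * n) = chi m * chi n.
Proof. by rewrite /chi kapM psiM // mulrACA. Qed.

Lemma chi_neq0M m n : (chi (m * n) != 0) = (chi m != 0) && (chi n != 0).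
Proof. by rewrite chiM mulf_eq0 negb_or. Qed.

Lemma chi1 : chi 1 = 1. Proof. by rewrite /chi kap1 psi1. Qed.

Lemma chi_val n : [|| chi n == 0, chi n == 1 | chi n == -1].
Proof. by rewrite /chi; case/or3P: (kap_val n) => /eqP->; case/or3P: (psi_val ps n) => /eqP->. Qed.

Lemma chi_eq0 n : (chi n == 0) = ~~ coprime n Q.
Proof.
rewrite /chi mulf_eq0 kap_eq0 psi_eq0 // coprimeMr negb_and; congr (~~ _ || _).
by rewrite -[8%N]/(2 ^ 3)%N coprime_pexpr // coprimen2.
Qed.

Lemma kap_congr m n : m = n %[mod 8] -> kap m = kap n.
Proof. by move=> e; rewrite -kap_mod e kap_mod. Qed.

Lemma chi_mod n : chi (n %% Q) = chi n.
Proof.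
have e8 : n %% Q = n %[mod 8] by rewrite modn_dvdm // dvdn_mulr.
have eM : n %% Q = n %[mod M] by rewrite modn_dvdm // dvdn_mull.
by rewrite /chi (kap_congr e8) (psi_congr ps_odd eM).
Qed.

Lemma prod_dvd D : {subset D <= ps} -> uniq D -> (\prod_(p <- D) p %| M)%N.
Proof.
move=> sD uD; have e : perm_eq ps (D ++ filter (fun p => p \notin D) ps).
  apply: uniq_perm => // [|p].
    by rewrite cat_uniq uD filter_uniq // andbT; apply/hasPn => p; rewrite mem_filter => /andP[].
  by rewrite mem_cat mem_filter; case: (boolP (p \in D)) => // /sD.
by rewrite /M (perm_big _ e) big_cat dvdn_mulr.
Qed.

Lemma psi_mod D n : odd_primes D -> {subset D <= ps} -> uniq D -> psi D (n %% Q) = psi D n.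
Proof.
move=> oD sD uD; apply: psi_congr => //; rewrite modn_dvdm //.
by rewrite dvdn_mull // prod_dvd.
Qed.

Lemma odd_primes_sub D : {subset D <= ps} -> odd_primes D.
Proof.
by case/andP: ps_odd => /allP h1 /allP h2 s; apply/andP; split; apply/allP => p /s; [apply: h1|apply: h2].
Qed.

Lemma psi_eq1 D n : odd_primes D -> n = 1 %[mod \prod_(p <- D) p] -> psi D n = 1.
Proof. by move=> oD e; rewrite (psi_congr oD e) psi1. Qed.

(* Their Dirichlet convolution is [chi ^ 2 * psi D * rep]; the factor [chi ^ 2] only
   restricts to integers prime to [Q]. *)
Definition psi_twist D n : int := chi n ^+ 2 * psi D n.
Definition chi_twist D n : int := chi n * psi D n.

Lemma twist_le1 D n : (`|psi_twist D n| <= 1) && (`|chi_twist D n| <= 1).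
Proof.
by rewrite /psi_twist /chi_twist; case/or3P: (chi_val n) => /eqP->; case/or3P: (psi_val D n) => /eqP->.
Qed.

(** The factor [kap] makes this character nontrivial for every [D]: take [u] with [kap u = -1] and
    [u = 1] modulo all primes of [ps]. *)
Lemma chi_twist_sum_bound D n : {subset D <= ps} -> uniq D -> `|\sum_(0 <= i < n) chi_twist D i| <= Q%:Z.
Proof.
move=> sD uD; have oD := odd_primes_sub sD; have [u0 kap_u0] := char8_N1 kapP.
have co8M : coprime 8 M by rewrite -[8%N]/(2 ^ 3)%N coprime_pexpl // coprime2n M_odd.
pose u := chinese 8 M u0 1.
have u8 : u = u0 %[mod 8] by apply: chinese_modl.
have uM : u = 1 %[mod M] by apply: chinese_modr.
have psu D' : {subset D' <= ps} -> uniq D' -> psi D' u = 1.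
  by move=> s1 s2; apply: psi_eq1; [apply: odd_primes_sub | apply: eq_mod_dvd uM; apply: prod_dvd].
have gu : chi_twist D u = -1 by rewrite /chi_twist /chi (kap_congr u8) kap_u0 !psu.
apply: (@char_sum_bound Q (chi_twist D) Q_gt0 _ _ _ u _ gu).
- by move=> k; rewrite /chi_twist chi_mod psi_mod.
- by move=> k; case/andP: (twist_le1 D k).
- by move=> j k; rewrite /chi_twist chiM psiM // mulrACA.
- by rewrite -[coprime u Q]negbK -chi_eq0 /chi (kap_congr u8) kap_u0 psu.
Qed.

(** Here [u] is a nonresidue modulo one prime of [D], and 1 modulo 8 and modulo the other primes of
    [ps]. For empty [D] the character would be principal. *)
Lemma psi_twist_sum_bound D n : D != [::] -> {subset D <= ps} -> uniq D -> `|\sum_(0 <= i < n) psi_twist D i| <= Q%:Z.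
Proof.
case: D => // p D _ sD uD; have oD := odd_primes_sub sD.
have pin : p \in ps by apply: sD; rewrite inE eqxx.
have [pp po] : prime p /\ odd p by move: oD; rewrite odd_primes_cons => /and3P[].
have [x qx] := quad_nonres pp po.
pose N := (8 * \prod_(j <- rem p ps) j)%N.
have coN : coprime p N.
  rewrite coprimeMr -[8%N]/(2 ^ 3)%N coprime_pexpr // coprimen2 po /=.
  rewrite coprime_prod_primes ?mem_rem_uniq ?inE ?eqxx //.
  by apply/allP => j /mem_rem; case/andP: ps_odd => /allP h _ /h.
pose u := chinese p N (val x) 1.
have up : u%:R = x by rewrite (natr_Fp_eq_mod pp (chinese_modl coN _ _)) natr_Zp.
have uN : u = 1 %[mod N] by apply: chinese_modr.
have psu D' : {subset D' <= rem p ps} -> psi D' u = 1.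
  move=> s1; rewrite /psi big1_seq // => j /andP[_ /s1 jin].
  have jps := mem_rem jin; case/andP: ps_odd => /allP/(_ _ jps) jp /allP/(_ _ jps) jo.
  rewrite (_ : u%:R = 1%:R) ?quad1 //; apply: (natr_Fp_eq_mod jp); apply: eq_mod_dvd uN.
  by rewrite /N (big_rem j) //= dvdn_mull // dvdn_mulr.
have u8 : u = 1 %[mod 8] by apply: eq_mod_dvd uN; rewrite dvdn_mulr.
have cu : chi u = -1.
  by rewrite /chi (kap_congr u8) kap1 (psi_perm _ (perm_to_rem pin)) psi_cons up qx psu ?mulN1r.
have fu : psi_twist (p :: D) u = -1.
  rewrite /psi_twist cu psi_cons up qx psu // => j jD; rewrite mem_rem_uniq // inE sD ?inE ?jD ?orbT // andbT.
  by apply/eqP => ej; move: uD; rewrite /= -ej jD.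
apply: (@char_sum_bound Q (psi_twist (p :: D)) Q_gt0 _ _ _ u _ fu).
- by move=> k; rewrite /psi_twist chi_mod psi_mod.
- by move=> k; case/andP: (twist_le1 (p :: D) k).
- by move=> j k; rewrite /psi_twist chiM psiM // exprMn mulrACA.
- by rewrite -[coprime u Q]negbK -chi_eq0 cu.
Qed.

(** For [n > 0], the number of ideals of norm [n] in the quadratic field attached to [chi]. *)
Definition rep n : int := \sum_(1 <= d < n.+1 | (d %| n)%N) chi d.

Lemma convolution D n : odd_primes D ->
  \sum_(1 <= m < n.+1 | (m %| n)%N) chi_twist D m * psi_twist D (n %/ m)%N = chi n ^+ 2 * psi D n * rep n.
Proof.
move=> oD; rewrite /rep mulr_sumr; apply: eq_bigr => m /dvdnP[k ->]; rewrite /psi_twist /chi_twist.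
case: (posnP m) => [->|m0].
  have chi0 : chi 0 = 0 by apply/eqP; rewrite chi_eq0 /coprime gcd0n /Q; lia.
  by rewrite muln0 chi0 !mul0r.
(* On the right, the term of [m] carries [chi m ^ 3]. *)
have chi3 : chi m ^+ 3 = chi m by case/or3P: (chi_val m) => /eqP->.
rewrite mulnK // chiM psiM //; move: (chi m) (chi k) (psi D m) (psi D k) chi3 => a b x y chi3.
by rewrite -[in LHS]chi3; ring.
Qed.

Section Bounded.
Variable R : rcfType.

Definition wsum (F : nat -> int) X : R := \sum_(1 <= n < (X * X).+1) (F n)%:~R * wt R n.

Definition bounded F := exists K : nat, forall X, `|wsum F X| <= K%:R.

Lemma boundedD F G (c : int) : bounded F -> bounded G -> bounded (fun n => F n + c * G n).
Proof.
move=> [K1 h1] [K2 h2]; exists (K1 + `|c| * K2)%N => X.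
have -> : wsum (fun n => F n + c * G n) X = wsum F X + c%:~R * wsum G X.
  by rewrite /wsum mulr_sumr -big_split; apply: eq_bigr => n _ /=; rewrite rmorphD rmorphM /= mulrDl mulrA.
apply: le_trans (ler_normD _ _) _; rewrite natrD natrM lerD // normrM ler_pM //.
by rewrite -intr_norm -abszE.
Qed.

Lemma eq_bounded F G : F =1 G -> bounded F -> bounded G.
Proof.
move=> e [K h]; exists K => X; suff <- : wsum F X = wsum G X by [].
by apply: eq_bigr => n _; rewrite e.
Qed.

Lemma psi_bounded D : D != [::] -> {subset D <= ps} -> uniq D ->
  bounded (fun n => chi n ^+ 2 * psi D n * rep n).
Proof.
move=> D0 sD uD; have oD := odd_primes_sub sD.
exists (4 * (Q * Q) + 8 * Q)%N => X.
have intb (F : nat -> int) n : `|\sum_(0 <= i < n) F i| <= Q%:Z ->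
    `|\sum_(0 <= i < n) ((F i)%:~R : R)| <= Q%:R.
  by rewrite -rmorph_sum /= -intr_norm [Q%:R]pmulrn ler_int.
have int1 (a : int) : `|a| <= 1 -> `|a%:~R : R| <= 1.
  by move=> h; rewrite -intr_norm (ler_int _ _ 1).
rewrite natrD [(4 * _)%:R]natrM [(8 * _)%:R]natrM [(Q * Q)%:R]natrM -expr2.
have := @hyperbola R (fun n => (chi_twist D n)%:~R) (fun n => (psi_twist D n)%:~R) Q%:R X.
rewrite /wsum => H; rewrite (eq_bigr (fun n =>
  (\sum_(1 <= m < n.+1 | (m %| n)%N) (chi_twist D m)%:~R * (psi_twist D (n %/ m)%N)%:~R) * wt R n)); last first.
  move=> n _; rewrite -convolution // rmorph_sum; congr (_ * _).
  by apply: eq_bigr => m _; rewrite rmorphM.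
apply: H => n; try (by apply: int1; case/andP: (twist_le1 D n)); apply: intb.
  exact: chi_twist_sum_bound.
exact: psi_twist_sum_bound.
Qed.

Variable t : nat -> int.

(** For signs [t p] and [n] prime to [D], this is a power of 2 if [(n/p) = t p] for all [p] in [D],
    and 0 otherwise. *)
Definition expand D n : int := \prod_(p <- D) (1 + t p * quad (n%:R : 'F_p)).

(** Expanding one factor either drops [p] or moves it to [D1], which stays nonempty, so every
    character that arises is nontrivial. *)
Lemma expand_bounded D2 D1 : D1 != [::] -> {subset D1 ++ D2 <= ps} -> uniq (D1 ++ D2) ->
  bounded (fun n => chi n ^+ 2 * psi D1 n * expand D2 n * rep n).
Proof.
elim: D2 D1 => [|p D2 IH] D1 D10 sD uD.
  rewrite cats0 in sD uD; apply: eq_bounded (psi_bounded D10 sD uD) => n.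
  by rewrite /expand big_nil mulr1.
have e : perm_eq (D1 ++ p :: D2) ((p :: D1) ++ D2) by rewrite -cat1s perm_catCA.
have h1 : bounded (fun n => chi n ^+ 2 * psi D1 n * expand D2 n * rep n).
  apply: IH => // [j jD|]; last by move: uD; rewrite (perm_uniq e) /= => /andP[].
  by apply: sD; rewrite (perm_mem e) inE jD orbT.
have h2 : bounded (fun n => chi n ^+ 2 * psi (p :: D1) n * expand D2 n * rep n).
  by apply: IH => // [j jD|]; [apply: sD; rewrite (perm_mem e) | rewrite -(perm_uniq e)].
apply: eq_bounded (boundedD (t p) h1 h2) => n.
by rewrite /expand big_cons psi_cons; ring.
Qed.

(** Subtracting 1 removes the principal character, the only term of the expansion without a
    bound. *)
Lemma expand_main D : {subset D <= ps} -> uniq D ->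
  bounded (fun n => chi n ^+ 2 * (expand D n - 1) * rep n).
Proof.
elim: D => [|p D IH] sD uD.
  exists 0%N => X; rewrite /wsum big1 ?normr0 // => n _.
  by rewrite /expand big_nil subrr mulr0 mul0r mul0r.
have h1 : bounded (fun n => chi n ^+ 2 * (expand D n - 1) * rep n).
  by apply: IH; [move=> j jD; apply: sD; rewrite inE jD orbT | case/andP: uD].
have h2 := @expand_bounded D [:: p] isT sD uD.
apply: eq_bounded (boundedD (t p) h1 h2) => n.
by rewrite /expand big_cons psi_cons /psi big_nil; ring.
Qed.
End Bounded.

(** * Multiplicativity and positivity of [rep] *)

Lemma rep_widen n Y : (0 < n <= Y)%N -> rep n = \sum_(1 <= d < Y.+1 | (d %| n)%N) chi d.
Proof.
move=> /andP[n0 nY]; rewrite [RHS](big_cat_nat (n := n.+1)) //= [X in _ = _ + X]big_nat_cond.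
by rewrite [X in _ = _ + X]big1 ?addr0 // => i /andP[/andP[i1 i2]] /dvdn_leq; lia.
Qed.

Lemma dvdn_primepow_split l k m d : prime l -> ~~ (l %| m)%N -> (0 < d)%N ->
  (d %| l ^ k.+1 * m)%N && ~~ (d %| l ^ k * m)%N
  = (l ^ k.+1 %| d)%N && (d %/ l ^ k.+1 %| m)%N.
Proof.
move=> pl lm d0; have L0 : (0 < l ^ k.+1)%N by rewrite expn_gt0 prime_gt0.
apply/andP/andP => [[d1 d2]|[/dvdnP[e ->]]]; last first.
  rewrite mulnK // => em; rewrite [(e * _)%N]mulnC dvdn_pmul2l // em; split=> //.
  apply: contra lm => /(dvdn_trans (dvdn_mulr e (dvdnn _))).
  by rewrite expnSr dvdn_pmul2l // expn_gt0 prime_gt0.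
have Ld : (l ^ k.+1 %| d)%N.
  rewrite pfactor_dvdn // ltnNge; apply: contra d2 => jk.
  have [d' co ed] := pfactor_coprime pl d0.
  rewrite ed mulnC dvdn_mul ?dvdn_exp2l //.
  rewrite -(@Gauss_dvdr d' (l ^ k.+1)); last by rewrite coprime_sym coprimeXl.
  by apply: dvdn_trans d1; rewrite ed dvdn_mulr.
by rewrite Ld; split=> //; rewrite -(dvdn_pmul2l L0) [(_ * (_ %/ _))%N]mulnC divnK.
Qed.

(** The divisors of [l^(k+1) m] that do not divide [l^k m] are the [l^(k+1) e] with [e] dividing
    [m]. *)
Lemma rep_primepow_step l k m : prime l -> ~~ (l %| m)%N -> (0 < m)%N ->
  rep (l ^ k.+1 * m) = rep (l ^ k * m) + chi l ^+ k.+1 * rep m.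
Proof.
move=> pl lm m0; have l0 := prime_gt0 pl; set N := (l ^ k.+1 * m)%N.
have [Lk0 L0] : (0 < l ^ k)%N /\ (0 < l ^ k.+1)%N by rewrite !expn_gt0 l0.
have chiX : chi (l ^ k.+1) = chi l ^+ k.+1.
  by elim: k.+1 => [|i IH]; rewrite ?chi1 // expnS chiM IH exprS.
rewrite [LHS]/rep (bigID (fun d => d %| l ^ k * m)%N) /=; congr (_ + _).
  rewrite (@rep_widen _ N); last by rewrite muln_gt0 Lk0 m0 leq_mul2r leq_exp2l ?prime_gt1 // leqnSn orbT.
  apply: eq_bigl => d; case: (boolP (d %| l ^ k * m)%N) => h; rewrite ?andbF // andbT.
  by apply: dvdn_trans h _; rewrite /N expnS -mulnA dvdn_mull.
transitivity (\sum_(1 <= d < N.+1 | (l ^ k.+1 %| d)%N)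
   (if (d %/ l ^ k.+1 %| m)%N then chi l ^+ k.+1 * chi (d %/ l ^ k.+1) else 0)).
  rewrite big_mkcond [RHS]big_mkcond; apply: eq_big_nat => d /andP[d0 _].
  rewrite dvdn_primepow_split //; case: (boolP (l ^ k.+1 %| d)%N) => //= h.
  by case: ifP => // _; rewrite -chiX -chiM mulnC divnK.
rewrite (sum_dvdn_reindex (fun e => if (e %| m)%N then chi l ^+ k.+1 * chi e else 0)) //.
rewrite -big_mkcondr (@rep_widen m N) ?m0 ?leq_pmull // mulr_sumr; apply: eq_bigl => e.
by rewrite andb_idl // => /(dvdn_leq m0); rewrite /N leq_pmul2l.
Qed.

Lemma rep_primepow l k m : prime l -> ~~ (l %| m)%N -> (0 < m)%N ->
  rep (l ^ k * m) = (\sum_(0 <= i < k.+1) chi l ^+ i) * rep m.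
Proof.
move=> pl lm m0; elim: k => [|k IH]; first by rewrite mul1n big_nat1 mul1r.
by rewrite rep_primepow_step // IH [in RHS]big_nat_recr //= mulrDl.
Qed.

Lemma sum_expr_sign (a : int) k : a = 1 \/ a = -1 ->
  \sum_(0 <= i < k) a ^+ i = if a == 1 then k%:Z else (odd k)%:Z.
Proof.
case=> ->; first by rewrite (eq_bigr (fun _ => 1)) => [|i _]; rewrite ?expr1n // sumr_const_nat subn0 natz.
elim: k => [|k IH]; first by rewrite big_geq.
by rewrite big_nat_recr //= IH -signr_odd; case: (odd k).
Qed.

Lemma chi_unit n : chi n != 0 -> chi n = 1 \/ chi n = -1.
Proof. by case/or3P: (chi_val n) => /eqP->; auto. Qed.

Lemma rep1 : rep 1 = 1.
Proof. by rewrite /rep big_mkcond big_nat1 /= chi1. Qed.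

Lemma pdiv_split n : (1 < n)%N -> exists l k m,
  [/\ prime l, ~~ (l %| m)%N, (0 < m < n)%N & n = (l ^ k.+1 * m)%N].
Proof.
move=> n1; have pl := pdiv_prime n1; have n0 := ltnW n1.
have [m co en] := pfactor_coprime pl n0.
have : (0 < logn (pdiv n) n)%N by rewrite logn_gt0 mem_primes pl n0 pdiv_dvd.
case: (logn _ _) en => // k en _; exists (pdiv n), k, m.
have m0 : (0 < m)%N by case: (m) en => // en'; rewrite en' mul0n in n0.
split=> //; first by rewrite -prime_coprime.
  by rewrite m0 {1}en ltn_Pmulr // (leq_trans (prime_gt1 pl)) // expnS leq_pmulr ?expn_gt0 ?prime_gt0.
by rewrite mulnC.
Qed.

(** All exponents in a square are even, so every local factor is a sum of an odd number of powers of
    1 or -1, hence positive. *)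
Lemma rep_sqr_ge1 j : (0 < j)%N -> chi j != 0 -> 1 <= rep (j * j).
Proof.
elim/ltn_ind: j => j IH j0 cj; case: (leqP j 1) => [j1|/pdiv_split[l [k [m [pl lm /andP[m0 mj] ej]]]]].
  have -> : j = 1%N by lia.
  by rewrite muln1 rep1.
have /andP[cl cm] : (chi l != 0) && (chi m != 0).
  by move: cj; rewrite ej expnS !chi_neq0M => /andP[/andP[-> _]] ->.
have -> : (j * j = l ^ (2 * k.+1) * (m * m))%N by rewrite ej mulnACA -expnD addnn -mul2n.
rewrite rep_primepow // ?muln_gt0 ?m0 // ?Euclid_dvdM ?negb_or ?lm //.
have := IH m mj m0 cm; rewrite sum_expr_sign; last exact: chi_unit.
have o : odd (2 * k.+1).+1 by lia.
by rewrite o; case: ifP; nia.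
Qed.

(** The local factor at [l^e] is [e + 1] if [chi l = 1], and 1 or 0 for even or odd [e] if
    [chi l = -1]. If [rep n] is nonzero, the primes of odd exponent thus satisfy [chi l = 1]; they
    form [L]. *)
Lemma rep_ge0_split n : (0 < n)%N -> chi n != 0 -> 0 <= rep n /\ (rep n != 0 ->
  exists L j, [/\ uniq L, all (fun l => prime l && (chi l == 1)) L, all (dvdn^~ n) L
               & n = ((\prod_(l <- L) l) * (j * j))%N]).
Proof.
elim/ltn_ind: n => n IH n0 cn; case: (leqP n 1) => [n1|/pdiv_split[l [k [m [pl lm /andP[m0 mn] en]]]]].
  have -> : n = 1%N by lia.
  rewrite rep1; split=> // _; exists [::], 1%N; by rewrite big_nil.
have /andP[cl cm] : (chi l != 0) && (chi m != 0).
  by move: cn; rewrite en expnS !chi_neq0M => /andP[/andP[-> _]] ->.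
have [r0 rm] := IH m mn m0 cm.
have sub L : all (dvdn^~ m) L -> all (dvdn^~ n) L.
  by move/allP => h; apply/allP => i /h im; rewrite en dvdn_mull.
rewrite en rep_primepow // sum_expr_sign; last exact: chi_unit.
rewrite -en; split; first by case: ifP => _; rewrite mulr_ge0.
rewrite mulf_eq0 negb_or => /andP[h /rm[L [j [uL aL dL em]]]].
case: (boolP (odd k)) h => ok h.
  exists L, (l ^ k.+1./2 * j)%N; split=> //; first exact: sub.
  rewrite {1}en; have -> : (l ^ k.+1 = l ^ k.+1./2 * l ^ k.+1./2)%N by rewrite -expnD; congr (_ ^ _)%N; lia.
  by rewrite {1}em; ring.
move: h; case: (boolP (chi l == 1)) => [c1 _|]; last by rewrite /= ok.
exists (l :: L), (l ^ k./2 * j)%N; split.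
- by rewrite /= uL andbT; apply: contra lm => /(allP dL).
- by rewrite /= pl c1.
- by rewrite /= sub // andbT en expnS -mulnA dvdn_mulr.
rewrite {1}en; have -> : (l ^ k.+1 = l * (l ^ k./2 * l ^ k./2))%N by rewrite -expnD -expnS; congr (_ ^ _)%N; lia.
by rewrite big_cons {1}em; ring.
Qed.

(* If all terms vanished, [expand_main] would bound the sum of [rep n / sqrt n], which diverges. *)
Lemma exists_represented (R : rcfType) (t : nat -> int) : exists n,
  [/\ (0 < n)%N, chi n != 0, rep n != 0 & expand t ps n != 0].
Proof.
have [K bK] := @expand_main R t ps (fun _ h => h) ps_uniq.
pose c n : R := (chi n ^+ 2 * rep n)%:~R.
have c0 n : 0 <= c n.
  rewrite /c ler0z; case: (posnP n) => [->|n0]; first by rewrite /rep big_geq // mulr0.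
  case: (eqVneq (chi n) 0) => [->|cn]; first by rewrite expr0n mul0r.
  by have [h _] := rep_ge0_split n0 cn; rewrite mulr_ge0 ?sqr_ge0.
have c1 m : (m = 1 %[mod Q])%N -> (0 < m)%N -> 1 <= c (m * m)%N.
  move=> m1 m0; have cm : chi m = 1 by rewrite -chi_mod m1 chi_mod chi1.
  by rewrite /c chiM cm mulr1 expr1n mul1r ler1z rep_sqr_ge1 // cm.
(* With this [k] the lower bound [k / 2 / Q] is [K + 1], just above the upper bound [K]. *)
pose k := (2 * Q * K.+1)%N.
have := sum_wt_unbounded k Q_gt0 c0 c1; set X := (Q * 2 ^ k)%N.
have -> : k%:R / 2 / Q%:R = K.+1%:R :> R.
  by rewrite /k !natrM; field; rewrite !pnatr_eq0 /=; lia.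
move=> lb.
case: (boolP (has (fun n => chi n ^+ 2 * expand t ps n * rep n != 0) (index_iota 1 (X * X).+1))).
  case/hasP=> n; rewrite mem_index_iota => /andP[n0 _].
  by move=> h; exists n; split=> //; apply: contraNneq h => ->; rewrite ?(expr0n, mul0r, mulr0).
move/hasPn => h0; exfalso; have := bK X.
(* Where the expanded term vanishes, only the subtracted 1 remains. *)
have -> : wsum R (fun n => chi n ^+ 2 * (expand t ps n - 1) * rep n) X
   = - \sum_(1 <= n < (X * X).+1) c n * wt R n.
  rewrite -sumrN; apply: eq_big_seq => n /h0 /negPn/eqP e.
  have -> : chi n ^+ 2 * (expand t ps n - 1) * rep n = - (chi n ^+ 2 * rep n).
    by rewrite mulrBr mulrBl e mulr1 sub0r.
  by rewrite rmorphN mulNr.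
rewrite normrN => /(le_trans (ler_norm _)) /(le_trans lb).
by rewrite ler_nat ltnn.
Qed.
End RepresentedIntegers.

(** * Existence of the auxiliary divisor *)

Lemma dvdn_quadratic_congr c N d x y : x = y %[mod d] ->
  (d %| c * (x * x) + N)%N = (d %| c * (y * y) + N)%N.
Proof.
move=> e; suff h : c * (x * x) + N = c * (y * y) + N %[mod d] by rewrite /dvdn h.
by rewrite -modnDml -modnMmr -(modnMm x) e modnMm modnMmr modnDml.
Qed.

(** Serves twice: with [c = 1] for [b^2 + N] modulo [a], and with 1 in place of [N] for
    [a s^2 + 1]. *)
Lemma crt_quadratic (c N : nat) L : uniq L -> all prime L ->
  (forall l, l \in L -> exists x, (l %| c * (x * x) + N)%N) ->
  exists x, (\prod_(l <- L) l %| c * (x * x) + N)%N.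
Proof.
elim: L => [|l L IH]; first by move=> _ _ _; exists 0%N; rewrite big_nil dvd1n.
move=> /= /andP[lL uL] /andP[pl aL] H.
have [x hx] := H l (mem_head _ _).
have [y hy] : exists y, (\prod_(l <- L) l %| c * (y * y) + N)%N.
  by apply: IH => // j jL; apply: H; rewrite inE jL orbT.
have co : coprime l (\prod_(j <- L) j) by apply: coprime_prod_primes.
exists (chinese l (\prod_(j <- L) j) x y); rewrite big_cons Gauss_dvd //; apply/andP; split.
  by rewrite (dvdn_quadratic_congr _ _ (chinese_modl co x y)).
by rewrite (dvdn_quadratic_congr _ _ (chinese_modr co x y)).
Qed.

(** For odd [p], whichever of [p] and [-p] is 1 modulo 4. *)
Definition pstar (p : nat) : int := quad (-1 : 'F_p) * p%:Z.

Lemma prod_pstar D : odd_primes D ->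
  (\prod_(p <- D) pstar p = (\prod_(p <- D) p)%N%:Z \/
   \prod_(p <- D) pstar p = - (\prod_(p <- D) p)%N%:Z) /\
  exists k, \prod_(p <- D) pstar p = 4 * k + 1.
Proof.
elim: D => [|p D IH]; first by rewrite !big_nil; split; [left | exists 0].
rewrite odd_primes_cons !big_cons => /and3P[pp po /IH[h [k ek] ] ].
have [j ej] : exists j, pstar p = 4 * j + 1.
  rewrite /pstar quadN1 // -signr_odd; case: (boolP (odd p./2)) => o.
    by exists (- (p./2./2)%:Z - 1); rewrite expr1; lia.
  by exists (p./2./2)%:Z; rewrite expr0; lia.
have ep : pstar p = p%:Z \/ pstar p = - p%:Z.
  by rewrite /pstar quadN1 // -signr_odd; case: odd; rewrite ?mul1r ?mulN1r; [right|left].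
split; last by exists (4 * j * k + j + k); rewrite ek ej; ring.
by case: h => ->; case: ep => ->; rewrite PoszM ?mulNr ?mulrN ?opprK; auto.
Qed.

Lemma psi_reciprocity D l : odd_primes D -> prime l -> odd l -> l \notin D ->
  (psi D l)%:~R = (\prod_(p <- D) pstar p)%:~R ^+ l./2 :> 'F_l.
Proof.
move=> oD pl lo; elim: D oD => [|p D IH]; first by rewrite /psi !big_nil expr1n.
rewrite odd_primes_cons inE negb_or => /and3P[pp po oD] /andP[lp lD].
rewrite psi_cons big_cons [(pstar p * _)%:~R]intrM [(_ * psi D l)%:~R]intrM exprMn IH // quad_reciprocity //.
by rewrite eq_sym.
Qed.

Lemma dvdn_of_Fp_quad l (N : nat) : prime l -> odd l ->
  (- N%:R : 'F_l) ^+ l./2 = 1 -> exists x, (l %| 1 * (x * x) + N)%N.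
Proof.
move=> pl lo; rewrite -quadE // => h.
have : quad (- N%:R : 'F_l) = 1.
  by apply: (sign_inj pl lo); rewrite ?quad_val // h.
case/(quad1_sqr pl lo) => y ey; exists (val y).
by rewrite mul1n (dvdn_pcharf (pchar_Fp pl)) natrD natrM natr_Zp -expr2 -ey addNr.
Qed.

Section AuxiliaryDivisor.
Variable R : rcfType.
Variables (kap : nat -> int) (ps : seq nat) (k0 : int).
Hypothesis kapP : char8 kap.
Hypotheses (ps_odd : odd_primes ps) (ps_uniq : uniq ps).
Hypothesis kap_Fp : forall l, prime l -> odd l -> k0%:~R ^+ l./2 = (kap l)%:~R :> 'F_l.

(** [a] is the product of the primes of odd exponent in a represented [n] with [(n/p) = (-1/p)] for
    all [p] in [ps]. Each prime [l] of [a] has [chi l = 1], so [-N] is a square modulo [l]; and [a]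
    equals [n] up to a square, so [-a] is a square modulo [p]. *)
Lemma auxiliary_divisor (N : nat) : k0 * \prod_(p <- ps) pstar p = - N%:Z ->
  exists a b, [/\ (0 < a)%N, odd a, (a %| 1 * (b * b) + N)%N &
    forall p, p \in ps -> exists s, (p %| a * (s * s) + 1)%N].
Proof.
move=> eN.
have [n [n0 cn rn en]] := exists_represented kapP ps_odd ps_uniq R (fun p => quad (-1 : 'F_p)).
have [_ H] := rep_ge0_split kapP ps_odd ps_uniq n0 cn.
have [L [j [uL aL dL eL]]] := H rn.
have LP l : l \in L -> [/\ prime l, odd l & l \notin ps /\ chi kap ps l = 1].
  move=> lL; have /andP[pl /eqP cl] := allP aL l lL.
  have : chi kap ps l != 0 by rewrite cl.
  rewrite /chi mulf_eq0 negb_or (char8_eq0 kapP) negbK psi_eq0 // negbK => /andP[lo co]; split=> //; split=> //.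
  apply/negP => lps; move: co; rewrite (big_rem l) //= coprimeMr /coprime gcdnn => /andP[/eqP l1 _].
  by rewrite l1 in pl.
exists (\prod_(l <- L) l)%N.
have [b hb] : exists b, (\prod_(l <- L) l %| 1 * (b * b) + N)%N.
  apply: crt_quadratic => // [|l /LP[pl lo [lps cl]]].
    by apply/allP => l /LP[].
  apply: dvdn_of_Fp_quad => //.
  have -> : - N%:R = (k0 * \prod_(p <- ps) pstar p)%:~R :> 'F_l by rewrite eN mulrNz.
  by rewrite intrM exprMn kap_Fp // -psi_reciprocity // -intrM -/(chi kap ps l) cl.
exists b; split=> //.
- by move: n0; rewrite eL muln_gt0 => /andP[].
- have : chi kap ps n != 0 by [].
  by rewrite /chi mulf_eq0 negb_or (char8_eq0 kapP) negbK eL oddM => /andP[/andP[]].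
move=> p pin.
have [pp po] : prime p /\ odd p.
  by case/andP: ps_odd => /allP/(_ _ pin) ? /allP/(_ _ pin).
have qn : quad (n%:R : 'F_p) != 0.
  move: cn; rewrite /chi mulf_eq0 negb_or => /andP[_]; rewrite /psi (big_rem p) //= mulf_eq0 negb_or.
  by case/andP.
have qj : quad (j%:R : 'F_p) != 0.
  by move: qn; rewrite eL !natrM !quadM // !mulf_eq0 !negb_or => /andP[_ /andP[]].
have : 1 + quad (-1 : 'F_p) * quad (n%:R : 'F_p) != 0.
  by move: en; rewrite /expand (big_rem p) //= mulf_eq0 negb_or => /andP[].
have -> : quad (n%:R : 'F_p) = quad ((\prod_(l <- L) l)%N%:R : 'F_p).
  rewrite eL !natrM !quadM //.
  by case/or3P: (quad_val (j%:R : 'F_p)) qj => /eqP-> //= _; rewrite ?mulr1 ?mulrN1 ?opprK.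
rewrite -quadM // mulN1r => h.
set a := (\prod_(l <- L) l)%N in h *.
have qa : quad (- a%:R : 'F_p) = 1.
  have : quad (- a%:R : 'F_p) != 0.
    rewrite -mulN1r quadM // mulf_eq0 negb_or quad_eq0 oppr_eq0 oner_eq0 /=.
    by move: qn; rewrite eL natrM quadM // mulf_eq0 negb_or => /andP[].
  by move: h; case/or3P: (quad_val (- a%:R : 'F_p)) => /eqP->.
have [y ey] := quad1_sqr pp po qa.
have y0 : y != 0.
  by apply: contra_eq_neq qa => y0; rewrite ey y0 expr0n /quad.
(* Since [a = - y^2] modulo [p], the inverse of [y] solves [a s^2 + 1 = 0]. *)
exists (val (y^-1)).
rewrite (dvdn_pcharf (pchar_Fp pp)) natrD !natrM natr_Zp; apply/eqP.
have -> : a%:R = - y ^+ 2 :> 'F_p by rewrite -ey opprK.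
by field.
Qed.
End AuxiliaryDivisor.

Lemma char8_table (s : seq int) (kap := (fun n => nth 0 s (n %% 8)) : nat -> int) :
  (forall i j, i \in iota 0 8 -> j \in iota 0 8 -> kap (i * j)%N == kap i * kap j) ->
  (forall i, i \in iota 0 8 -> [|| kap i == 0, kap i == 1 | kap i == -1] && ((kap i == 0) == ~~ odd i)) ->
  kap 1 = 1 -> (exists u, kap u = -1) -> char8 kap.
Proof.
have modE n : kap (n %% 8)%N = kap n by rewrite /kap modn_mod.
have mod_in n : (n %% 8)%N \in iota 0 8 by rewrite mem_iota ltn_mod.
move=> hM hv h1 hN; split=> // [m n|n|n].
- by rewrite -modE -(modE m) -(modE n) -modnMm modE; apply/eqP/hM.
- by rewrite -modE; case/andP: (hv _ (mod_in n)).
- by rewrite -modE; case/andP: (hv _ (mod_in n)) => _ /eqP ->; lia.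
Qed.

Lemma chi4_char8 : char8 chi4.
Proof.
apply: char8_table => // [i j||]; last by exists 3%N.
  by rewrite !inE; do 7?[case/orP]; move=> /eqP->; do 7?[case/orP]; move=> /eqP->.
by move=> i; rewrite !inE; do 7?[case/orP]; move=> /eqP->.
Qed.

Lemma chi8_char8 : char8 chi8.
Proof.
apply: char8_table => // [i j||]; last by exists 3%N.
  by rewrite !inE; do 7?[case/orP]; move=> /eqP->; do 7?[case/orP]; move=> /eqP->.
by move=> i; rewrite !inE; do 7?[case/orP]; move=> /eqP->.
Qed.

Lemma chi4_Fp l : prime l -> odd l -> (-1)%:~R ^+ l./2 = (chi4 l)%:~R :> 'F_l.
Proof.
move=> pl lo; have -> : (-1)%:~R = -1 :> 'F_l by [].
rewrite -signr_odd /chi4.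
have : (l %% 8 = 1 \/ l %% 8 = 3 \/ l %% 8 = 5 \/ l %% 8 = 7)%N by lia.
case=> [|[|[|]]] e; rewrite e /=.
- by rewrite (_ : odd l./2 = false) //; lia.
- by rewrite (_ : odd l./2 = true) //; lia.
- by rewrite (_ : odd l./2 = false) //; lia.
- by rewrite (_ : odd l./2 = true) //; lia.
Qed.

Lemma squarefree_split n : (0 < n)%N -> exists L c,
  [/\ uniq L, all prime L, all (dvdn^~ n) L & n = ((\prod_(l <- L) l) * (c * c))%N].
Proof.
elim/ltn_ind: n => n IH n0; case: (leqP n 1) => [n1|/pdiv_split[l [k [m [pl lm /andP[m0 mn] en]]]]].
  by exists [::], 1%N; rewrite big_nil; split=> //; lia.
have [L [c [uL aL dL em]]] := IH m mn m0.
have sub : all (dvdn^~ n) L.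
  by apply/allP => i /(allP dL) im; rewrite en dvdn_mull.
case: (boolP (odd k)) => ok.
  exists L, (l ^ k.+1./2 * c)%N; split=> //.
  rewrite {1}en; have -> : (l ^ k.+1 = l ^ k.+1./2 * l ^ k.+1./2)%N by rewrite -expnD; congr (_ ^ _)%N; lia.
  by rewrite {1}em; ring.
exists (l :: L), (l ^ k./2 * c)%N; split=> //.
- by rewrite /= uL andbT; apply: contra lm => /(allP dL).
- by rewrite /= pl.
- by rewrite /= sub andbT en expnS -mulnA dvdn_mulr.
rewrite {1}en; have -> : (l ^ k.+1 = l * (l ^ k./2 * l ^ k./2))%N by rewrite -expnD -expnS; congr (_ ^ _)%N; lia.
by rewrite big_cons {1}em; ring.
Qed.

(** The odd part of [N] is [M c^2] with [M] squarefree, and [c^2 = 1] modulo 8. The product of the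
    [pstar p] is [M] or [-M], whichever is 1 modulo 4; hence [-M] is -1 times it in the first case
    and [-2 M] is 2 times it in the second. *)
Lemma three_squares_data (N : nat) : (N %% 4 = 1 \/ N %% 8 = 6)%N ->
  exists m c a b s, [/\ N = (m * (c * c))%N, (0 < m)%N, (0 < a)%N, (a %| b * b + m)%N & (m %| a * (s * s) + 1)%N].
Proof.
move=> hN.
pose N' := if odd N then N else N./2.
have N'_odd : odd N' by rewrite /N'; case: ifP; lia.
have [|L [c [uL aL dL eL]]] := @squarefree_split N'; first by case: (N') N'_odd.
have oL : odd_primes L.
  rewrite /odd_primes aL; apply/allP => l /(allP dL) /dvdnP[k ek].
  by move: N'_odd; rewrite ek oddM => /andP[].
have c_odd : odd c by move: N'_odd; rewrite eL !oddM => /andP[_ /andP[]].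
set M := (\prod_(l <- L) l)%N in eL.
have c8 : (c * c = 1 %[mod 8])%N.
  have : (c %% 8 = 1 \/ c %% 8 = 3 \/ c %% 8 = 5 \/ c %% 8 = 7)%N by lia.
  by rewrite -modnMm => -[|[|[|]]] ->.
have MN : M = N' %[mod 8] by rewrite eL -modnMmr c8 modnMmr muln1.
have [hs [k hk]] := prod_pstar oL.
have key (P j : int) : P = M%:Z \/ P = - M%:Z -> P = 4 * j + 1 ->
  ((M %% 4)%N = 1%N -> P = M%:Z) /\ ((M %% 4)%N = 3 -> P = - M%:Z) by lia.
have [eP1 eP3] := key _ _ hs hk.
case: hN => hN.
  have eN : N' = N by rewrite /N'; case: ifP; lia.
  have eM : (-1) * \prod_(p <- L) pstar p = - M%:Z by rewrite eP1 ?mulN1r //; lia.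
  have [a [b [a0 ao ha hs']]] := auxiliary_divisor realalg chi4_char8 oL uL chi4_Fp eM.
  have [s hs2] := crt_quadratic uL aL hs'.
  by exists M, c, a, b, s; rewrite -eN; split=> //; [rewrite prod_odd_primes_gt0 | rewrite mul1n in ha].
have eN : (2 * N')%N = N by rewrite /N'; case: ifP; lia.
have eM : 2 * \prod_(p <- L) pstar p = - (2 * M)%N%:Z by rewrite eP3 ?mulrN //; lia.
have [a [b [a0 ao ha hs']]] := auxiliary_divisor realalg chi8_char8 oL uL (fun q pq oq => quad_two pq oq : 2%:~R ^+ q./2 = _) eM.
(* At the additional prime 2, [s = 1] works because [a] is odd. *)
have [s hs2] : exists s, (\prod_(l <- 2%N :: L) l %| a * (s * s) + 1)%N.
  apply: crt_quadratic => /=; rewrite ?uL ?aL ?andbT //.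
    by apply: contraL oL => L2; apply/nandP; right; apply/allPn; exists 2%N.
  by move=> l; rewrite inE => /orP[/eqP->|/hs' //]; exists 1%N; lia.
exists (2 * M)%N, c, a, b, s; rewrite big_cons in hs2; rewrite mul1n in ha.
by split=> //; [rewrite -mulnA -eL eN | rewrite muln_gt0 prod_odd_primes_gt0].
Qed.

(* Spelled with [Nat.add] and [Nat.mul], which MathComp's [addn] and [muln] unfold to. *)
Lemma three_squares_data_nat (N k : nat) :
  N = Nat.add (Nat.mul 4 k) 1 \/ N = Nat.add (Nat.mul 8 k) 6 ->
  exists m c a b s i j,
    N = Nat.mul m (Nat.mul c c) /\ lt 0 m /\ lt 0 a /\
    Nat.add (Nat.mul b b) m = Nat.mul i a /\ Nat.add (Nat.mul a (Nat.mul s s)) 1 = Nat.mul j m.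
Proof.
move=> hN; have [|m [c [a [b [s [-> /ssrnat.ltP m0 /ssrnat.ltP a0 /dvdnP[i hi] /dvdnP[j hj]]]]]]] := @three_squares_data N.
  by lia.
by exists m, c, a, b, s, i, j.
Qed.
End ThreeSquares.

(** * The three-square theorem and the conclusion *)

Lemma three_squares N : 0 < N -> N mod 4 = 1 \/ N mod 8 = 6 -> sum3sq N.
Proof.
  intros HN Hmod.
  assert (HN' : exists k, (Z.to_nat N = 4 * k + 1 \/ Z.to_nat N = 8 * k + 6)%nat).
  { destruct Hmod as [H | H];
      [exists (Z.to_nat (N / 4)); pose proof (Z.div_mod N 4) | exists (Z.to_nat (N / 8)); pose proof (Z.div_mod N 8)];
      pose proof (Z.div_pos N 4); pose proof (Z.div_pos N 8); lia. }
  destruct HN' as [k Hk].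
  destruct (ThreeSquares.three_squares_data_nat Hk) as (m & c & a & b & s & i & j & H1 & H2 & H3 & H4 & H5).
  destruct (sum3sq_of_residues (Z.of_nat m) (Z.of_nat a) (Z.of_nat b) (Z.of_nat s)) as (x & y & z & Hxyz);
    [lia | lia | exists (Z.of_nat i); nia | exists (Z.of_nat j); nia |].
  (* A representation of the squarefree part [m] is scaled by [c]. *)
  exists (Z.of_nat c * x), (Z.of_nat c * y), (Z.of_nat c * z).
  transitivity (Z.of_nat m * (Z.of_nat c * Z.of_nat c)); [lia | rewrite Hxyz; ring].
Qed.

(* Stdlib world: binary integers Z and the classical reals R. *)
Theorem theorem2 :
  forall lam : Z, (0 < lam)%Z -> Z.Odd lam ->
    (forall n : Z, (IZR n >= IZR lam ^ 2 / 8)%R ->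
      exists x y z w : Z,
        (n = x ^ 2 + y ^ 2 + z ^ 2 + 2 * w ^ 2)%Z /\
        (x + y + 2 * z + 2 * w = lam)%Z) /\
    (forall n : Z, (IZR n >= IZR lam ^ 2 / 16)%R ->
      exists x y z w : Z,
        (n = x ^ 2 + y ^ 2 + z ^ 2 + 2 * w ^ 2)%Z /\
        (x + 2 * y + 3 * z + 2 * w = lam)%Z) /\
    (~ (7 | lam)%Z ->
      forall n : Z, Z.Odd n -> (IZR n >= IZR lam / sqrt 14)%R ->
        exists x y z w : Z,
          (n ^ 2 = x ^ 2 + y ^ 2 + z ^ 2 + w ^ 2)%Z /\
          (x + 2 * y + 3 * z = lam)%Z).
Proof.
  intros lam Hlam Hodd; repeat split.
  - intros n Hn; apply (sum_with_form_1122 three_squares); [exact Hodd|].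
    apply le_IZR; rewrite Z.pow_2_r, !mult_IZR; lra.
  - intros n Hn; apply (sum_with_form_1232 three_squares); [exact Hodd|].
    apply le_IZR; rewrite Z.pow_2_r, !mult_IZR; lra.
  - intros H7 n Hnodd Hn; apply (square_with_form_1230 three_squares); auto.
    apply le_IZR; rewrite !Z.pow_2_r, !mult_IZR.
    assert (Hs : (0 < sqrt 14)%R) by (apply sqrt_lt_R0; lra).
    assert (Hs2 : (sqrt 14 * sqrt 14 = 14)%R) by (apply sqrt_sqrt; lra).
    apply IZR_lt in Hlam.
    assert (Hle : (IZR lam <= IZR n * sqrt 14)%R).
    { replace (IZR lam) with (IZR lam / sqrt 14 * sqrt 14)%R by (field; lra).
      apply Rmult_le_compat_r; lra. }
    assert ((IZR lam * IZR lam <= (IZR n * sqrt 14) * (IZR n * sqrt 14))%R)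
      by (apply Rmult_le_compat; lra).
    replace 14%R with (sqrt 14 * sqrt 14)%R; lra.
Qed.
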